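(* Let $\alpha\in(0,1]$, $\mathbb T^{A}\in\mathcal T_\alpha$ be arbitrary and $t_0\ge0$. Then $\mathbb T^{G(t_0)},\mathbb T^{G(t_0+1)}\in\mathcal T_\alpha$, and under model $\mathcal M_{\mathrm s}$, for all $t=1,2,\dots$, $$\mathbb E\big(\mathrm U_t(\mathbb T^{A})\big)\le\mathbb E\big(\mathrm U_t(\mathbb T^{G(t_0+1)})\big)\le\mathbb E\big(\mathrm U_t(\mathbb T^{G(t_0)})\big)\le\mathbb E\big(\mathrm U_t(\mathbb T^* )\big).$$
   Context: There are $K\ge1$ data streams. Each stream $k$ has a change point $\tau_k\in\{0,1,2,\dots\}\cup\{\infty\}$. Observations $X_{k,t}$ ($1\le k\le K$, $t=1,2,\dots$) are, conditionally on $(\tau_1,\dots,\tau_K)$, independent over $k$ and $t$, with $X_{k,t}$ having density $p_{k,t}$ if $t\le\tau_k$ and $q_{k,t}$ if $t>\tau_k$ with respect to a baseline measure $\mu$. Model $\mathcal M_{\mathrm s}$: $\tau_1,\dots,\tau_K$ are i.i.d. with $\mathbb P(\tau_k=m)=\theta(1-\theta)^m$, $m=0,1,2,\dots$, for some $\theta\in(0,1)$, and $p_{k,t}=p$, $q_{k,t}=q$ for all $k,t$. A compound sequential detection procedure consists of index sets $S_1=\{1,\dots,K\}\supseteq S_2\supseteq\cdots$ and a filtration defined inductively by $\mathcal F_1=\sigma(X_{k,1}:1\le k\le K)$ and $\mathcal F_t=\sigma(\mathcal F_{t-1},S_t,X_{k,t}:k\in S_t)$ for $t>1$, where $S_t$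 is required to be $\mathcal F_{t-1}$-measurable. $\mathcal T$ is the set of all such procedures. For $t\ge1$, $\mathrm{FNP}_{t+1}(\mathbb T)=\sum_{k\in S_{t+1}}\mathbf 1(\tau_k<t)/(|S_{t+1}|\vee1)$, $\mathrm{LFNR}_{t+1}(\mathbb T)=\mathbb E(\mathrm{FNP}_{t+1}(\mathbb T)\mid\mathcal F_t)$, $\mathrm{LFNR}_1(\mathbb T)=0$. $\mathcal T_\alpha=\{\mathbb T\in\mathcal T:\mathrm{LFNR}_t(\mathbb T)\le\alpha\text{ a.s. for all }t\ge1\}$. Stream utilization: $\mathrm U_t(\mathbb T)=\sum_{s=1}^t|S_s|$. Posterior probabilities: $W_{k,t}=\mathbb P(\tau_k<t\mid\mathcal F_t)$. One-step update rule: given $\alpha$, $S_t$ and $(W_{k,t})_{k\in S_t}$, write $S_t=\{k_1,\dots,k_m\}$ ordered so that $W_{k_1,t}\le\cdots\le W_{k_m,t}$, ties broken so that $k_i<k_{i+1}$ when $W_{k_i,t}=W_{k_{i+1},t}$; set $R_0=0$ and $R_n=\frac1n\sum_{i=1}^nW_{k_i,t}$; let $n$ be the largest element of $\{0,\dots,m\}$ with $R_n\le\alpha$; output $S_{t+1}=\{k_1,\dots,k_n\}$ ($\emptyset$ if $n=0$). The proposed procedure $\mathbb T^*$: $S_1=\{1,\dots,K\}$ and, for every $t\ge1$, $S_{t+1}$ is the output of the one-step rule applied to $S_t$ and $(W_{k,t})_{k\in S_t}$. Switching procedure: for $\mathbb T^A\in\mathcal T_\alpha$ with active sets $S^A_t$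 and $t_0\ge0$, $\mathbb T^{G(t_0)}$ is the procedure with $S^{G(t_0)}_t=S^A_t$ for $1\le t\le t_0$ and, for every $t\ge\max(t_0,1)$, $S^{G(t_0)}_{t+1}$ equal to the output of the one-step rule applied to $S^{G(t_0)}_t$ and its own posteriors $W^{G(t_0)}_{k,t}=\mathbb P(\tau_k<t\mid\mathcal F^{G(t_0)}_t)$. In particular $\mathbb T^{G(0)}=\mathbb T^*$. *)

(* Defs.v *)
From HB Require Import structures.
From mathcomp Require Import all_boot all_order all_algebra.
From mathcomp Require Import all_classical all_reals all_analysis.
Set Implicit Arguments. Unset Strict Implicit. Unset Printing Implicit Defensive.
Import Order.TTheory GRing.Theory Num.Theory.
Local Open Scope classical_set_scope.
Local Open Scope ring_scope.

(* Change points take values in {0,1,2,...} U {oo}; [None] encodes oo. *)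
Definition tau_lt (m : option nat) (t : nat) : bool :=
  if m is Some m' then (m' < t)%N else false.

Definition dens {R : realType} {K : nat} {Xs : Type}
  (pd qd : 'I_K -> nat -> Xs -> R) (k : 'I_K) (t : nat) (m : option nat) : Xs -> R :=
  if tau_lt m t then qd k t else pd k t.

Definition rule {R : realType} (K : nat) (alpha : R) (S : {set 'I_K})
    (W : 'I_K -> R) : {set 'I_K} :=
  let s := sort (fun i j : 'I_K => (W i < W j) || ((W i == W j) && (val i <= val j)%N))
                (enum S) in
  let Rn (n : nat) : R :=
      if n == 0%N then 0 else (\sum_(i <- take n s) W i) / n%:R in
  let n := (\max_(n < (size s).+1 | (Rn n <= alpha)%R) (n : nat))%N in
  [set i in take n s].

(* Generators added at time t: sigma(S_t, X_{k,t} : k in S_t). *)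
Definition gens {K : nat} {T : Type} {dX : measure_display} {Xs : measurableType dX}
  (X : 'I_K -> nat -> T -> Xs) (S : nat -> T -> {set 'I_K}) (t : nat) : set (set T) :=
  [set A | (exists s : {set 'I_K}, A = [set w | S t w = s]) \/
           (exists (k : 'I_K) (B : set Xs),
              measurable B /\ A = [set w | k \in S t w /\ B (X k t w)])].

(* filtr X S t = F_t  (F_0 is the trivial sigma-algebra, F_1 = sigma(X_{k,1} : k)). *)
Fixpoint filtr {K : nat} {T : Type} {dX : measure_display} {Xs : measurableType dX}
  (X : 'I_K -> nat -> T -> Xs) (S : nat -> T -> {set 'I_K}) (t : nat) : set (set T) :=
  match t with
  | 0%N => [set A | A = set0 \/ A = setT]
  | t'.+1 => <<s filtr X S t' `|` gens X S t'.+1 >>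
  end.

Definition Gmeas {R : realType} {T : Type} (G : set (set T)) (Z : T -> R) :=
  forall B : set R, measurable B -> G (Z @^-1` B).

Definition is_cexp {R : realType} {d : measure_display} {T : measurableType d}
  (P : probability T R) (G : set (set T)) (Y Z : T -> R) :=
  [/\ Gmeas G Z, P.-integrable setT (EFin \o Z) &
      forall A, G A -> (\int[P]_(w in A) (Z w)%:E = \int[P]_(w in A) (Y w)%:E)%E].

Definition is_proc {K : nat} {T : Type} {dX : measure_display} {Xs : measurableType dX}
  (X : 'I_K -> nat -> T -> Xs) (S : nat -> T -> {set 'I_K}) :=
  [/\ forall w, S 1%N w = [set: 'I_K]%SET,
      forall t w, (1 <= t)%N -> S t.+1 w \subset S t w &
      forall t (s : {set 'I_K}), (1 <= t)%N -> filtr X S t [set w | S t.+1 w = s]].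

Definition FNP {R : realType} {K : nat} {T : Type} (tau : 'I_K -> T -> option nat)
  (S : nat -> T -> {set 'I_K}) (t : nat) (w : T) : R :=
  (\sum_(k in S t.+1 w) (tau_lt (tau k w) t)%:R) / (maxn #|S t.+1 w| 1)%:R.

(* S in T_alpha : LFNR_1 = 0 and, for t >= 1, (every version of)
   LFNR_{t+1} = E(FNP_{t+1} | F_t) is <= alpha almost surely. *)
Definition in_Talpha {R : realType} {K : nat} {d : measure_display} {T : measurableType d}
  (P : probability T R) {dX : measure_display} {Xs : measurableType dX}
  (tau : 'I_K -> T -> option nat) (X : 'I_K -> nat -> T -> Xs) (alpha : R)
  (S : nat -> T -> {set 'I_K}) :=
  is_proc X S /\
  forall t, (1 <= t)%N -> forall Z : T -> R, is_cexp P (filtr X S t) (FNP tau S t) Z ->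
    {ae P, forall w, Z w <= alpha}.

Definition is_switch {R : realType} {K : nat} {d : measure_display} {T : measurableType d}
  (P : probability T R) {dX : measure_display} {Xs : measurableType dX}
  (tau : 'I_K -> T -> option nat) (X : 'I_K -> nat -> T -> Xs) (alpha : R)
  (A : nat -> T -> {set 'I_K}) (t0 : nat) (G : nat -> T -> {set 'I_K}) :=
  [/\ forall w, G 1%N w = [set: 'I_K]%SET,
      forall t w, (1 <= t <= t0)%N -> G t w = A t w &
      exists W : nat -> 'I_K -> T -> R,
        forall t, (maxn t0 1 <= t)%N ->
          (forall k, is_cexp P (filtr X G t) (fun w => (tau_lt (tau k w) t)%:R) (W t k)) /\
          (forall w, G t.+1 w = rule alpha (G t w) (fun k => W t k w))].

Definition is_Tstar {R : realType} {K : nat} {d : measure_display} {T : measurableType d}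
  (P : probability T R) {dX : measure_display} {Xs : measurableType dX}
  (tau : 'I_K -> T -> option nat) (X : 'I_K -> nat -> T -> Xs) (alpha : R)
  (G : nat -> T -> {set 'I_K}) :=
  (forall w, G 1%N w = [set: 'I_K]%SET) /\
  exists W : nat -> 'I_K -> T -> R,
    forall t, (1 <= t)%N ->
      (forall k, is_cexp P (filtr X G t) (fun w => (tau_lt (tau k w) t)%:R) (W t k)) /\
      (forall w, G t.+1 w = rule alpha (G t w) (fun k => W t k w)).

Definition util {K : nat} {T : Type} (S : nat -> T -> {set 'I_K}) (t : nat) (w : T) : nat :=
  (\sum_(1 <= s < t.+1) #|S s w|)%N.

Definition EU {R : realType} {K : nat} {d : measure_display} {T : measurableType d}
  (P : probability T R) (S : nat -> T -> {set 'I_K}) (t : nat) : \bar R :=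
  (\int[P]_w ((util S t w)%:R)%:E)%E.

(* The general observation model: conditionally on (tau_1..tau_K), the X_{k,t}
   (t >= 1) are independent, X_{k,t} with density p_{k,t} (t <= tau_k) or
   q_{k,t} (t > tau_k) w.r.t. mu. *)
Definition gen_model {R : realType} {K : nat} {d : measure_display} {T : measurableType d}
  (P : probability T R) {dX : measure_display} {Xs : measurableType dX}
  (mu : {measure set Xs -> \bar R})
  (tau : 'I_K -> T -> option nat) (X : 'I_K -> nat -> T -> Xs)
  (pd qd : 'I_K -> nat -> Xs -> R) :=
  [/\ forall k m, measurable [set w | tau k w = m],
      forall k t, measurable_fun setT (X k t),
      forall k t, [/\ forall x, 0 <= pd k t x, measurable_fun setT (pd k t) &
                      (\int[mu]_x (pd k t x)%:E = 1)%E],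
      forall k t, [/\ forall x, 0 <= qd k t x, measurable_fun setT (qd k t) &
                      (\int[mu]_x (qd k t x)%:E = 1)%E] &
      forall (v : 'I_K -> option nat) (F : seq ('I_K * nat)) (B : 'I_K * nat -> set Xs),
        uniq F -> (forall kt, kt \in F -> (0 < kt.2)%N) ->
        (forall kt, measurable (B kt)) ->
        P [set w | (forall k, tau k w = v k) /\ forall kt, kt \in F -> B kt (X kt.1 kt.2 w)]
        = (P [set w | forall k, tau k w = v k] *
           \prod_(kt <- F) \int[mu]_(x in B kt) (dens pd qd kt.1 kt.2 (v kt.1) x)%:E)%E].

Definition model_Ms {R : realType} {K : nat} {d : measure_display} {T : measurableType d}
  (P : probability T R) {Xs : Type}
  (tau : 'I_K -> T -> option nat) (pd qd : 'I_K -> nat -> Xs -> R) :=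
  exists theta : R, [/\ 0 < theta < 1,
    forall v : 'I_K -> nat,
      P [set w | forall k, tau k w = Some (v k)] = (\prod_k (theta * (1 - theta) ^+ v k))%:E &
    exists p q : Xs -> R, forall k t, (0 < t)%N -> pd k t = p /\ qd k t = q].

(* Main.v *)
Require Import Defs.
From HB Require Import structures.
From mathcomp Require Import all_boot all_order fingroup perm all_algebra.
From mathcomp Require Import all_classical all_reals all_analysis.
From mathcomp Require Import measurable_realfun.
From mathcomp Require Import ring lra.
Set Implicit Arguments. Unset Strict Implicit. Unset Printing Implicit Defensive.
Import Order.TTheory GRing.Theory Num.Theory.
Local Open Scope ring_scope.

(* Given the history of all streams, the utilization still to come under the
   one-step rule has an expectation [value n S v] that depends only on the number
   [n] of remaining steps, the active set [S] and the posteriors [v], through a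
   Bellman recursion. It is monotone: if [D] injects into [S] without increasing
   the posteriors, then [value n D v <= value n S w]. Two facts propagate this.
   First, the rule keeps as many streams as an admissible set can contain, and
   those with the smallest posteriors, so that an admissible [D] still injects in
   this way into the selection made by the rule. Second, the Bayes update is
   stochastically increasing in the prior and the streams are independent with a
   common law, so that the order survives averaging over the next observations.
   Hence, if the rule is used from time [t + 1] on, a selection at time [t] whose
   LFNR is at most [alpha] gives no more utilization than the selection of the
   rule. Iterating backwards from the horizon compares a procedure in T_alpha with
   any procedure that coincides with it up to some time and then uses the rule. *)

(** * The one-step rule *)

(** Different procedures observe different streams, so their filtrations are not comparable. All of
    them are therefore placed in the history of all streams, including those already dropped.
    Nothing changes on active streams: active sets decrease, so an active stream has been observed
    from the start, and by independence its posterior depends on its own observations only. The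
    posteriors of dropped streams keep evolving, but [value n S v] reads [v] on [S] only. In
    exchange, the law of the next round does not depend on the active set, and two active sets
    matched by a permutation of the streams can be averaged over the same round after relabelling.
    No conditional law is constructed. Conditional statements are equalities of integrals over the
    events of a history, checked on rectangles and extended by uniqueness of measures on a
    pi-system. They rest on the lack of memory of the geometric law: delaying a change that is still
    to come multiplies the weight by [1 - theta]. *)

Section Rule.
Context {R : realType} {K : nat} (alpha : R).
Implicit Types (S B Z : {set 'I_K}) (W : 'I_K -> R) (i j k : 'I_K).

Definition rle W : rel 'I_K :=
  fun i j => (W i < W j) || ((W i == W j) && (val i <= val j)%N).

Lemma rle_refl W : reflexive (rle W).
Proof. by move=> i; rewrite /rle eqxx leqnn orbT. Qed.

Lemma rle_total W : total (rle W).
Proof.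
by move=> i j; rewrite /rle; case: (ltgtP (W i) (W j)) => //= _; exact: leq_total.
Qed.

Lemma rle_trans W : transitive (rle W).
Proof.
move=> j i k; rewrite /rle => /orP[ij|/andP[/eqP ij lij]] /orP[jk|/andP[/eqP jk ljk]].
- by rewrite (lt_trans ij jk).
- by rewrite -jk ij.
- by rewrite ij jk.
- by rewrite ij jk eqxx (leq_trans lij ljk) orbT.
Qed.

Lemma rle_anti W : antisymmetric (rle W).
Proof.
move=> i j; rewrite /rle => /andP[].
case: (ltgtP (W i) (W j)) => //= _ ij ji; apply/val_inj/eqP.
by rewrite eqn_leq ij ji.
Qed.

Lemma rle_le W i j : rle W i j -> W i <= W j.
Proof. by case/orP => [/ltW//|/andP[/eqP->]]. Qed.

Definition below S W k : {set 'I_K} := [set j in S | rle W j k].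

Definition excess S W : R := \sum_(i in S) (W i - alpha).

Lemma excess_gt0 S W k : {in S, forall i, W i <= W k} -> 0 < excess S W -> alpha < W k.
Proof.
move=> Sk; rewrite ltNge [_ < _]ltNge; apply: contra => Wk.
by apply: sumr_le0 => i /Sk Wi; rewrite subr_le0 (le_trans Wi).
Qed.

(** Along the sorted streams, a running sum of [W - alpha] that is positive has a positive last
    term; all later terms are then positive too, so it stays positive. *)
Lemma excess_below_mono S W j k : k \in S -> rle W j k ->
  excess (below S W k) W <= 0 -> excess (below S W j) W <= 0.
Proof.
move=> kS jk; apply: contraLR; rewrite -!ltNge => ej.
have aj : alpha < W j.
  by apply: excess_gt0 ej => i; rewrite inE => /andP[_ /rle_le].
have sub : below S W j \subset below S W k.
  by apply/fintype.subsetP => i; rewrite !inE => /andP[-> /= /rle_trans]; apply.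
rewrite /excess (big_setID (below S W j)) /= (finset.setIidPr sub).
rewrite ltr_wpDr// sumr_ge0// => i; rewrite !inE subr_ge0 => /andP[+ /andP[iS ik]].
rewrite iS /= => /negbTE ij; have := rle_total W i j; rewrite ij /= => /rle_le ji.
exact/ltW/(lt_le_trans aj).
Qed.

(** Removes the sorting and the maximum from the rule: since the admissible prefixes are closed
    under shortening, a stream is selected exactly when the prefix ending at it is admissible. *)
Lemma rule_le S W k : k \in rule alpha S W = (k \in S) && (excess (below S W k) W <= 0).
Proof.
rewrite /rule -/(rle W) !inE.
set s := sort (rle W) (enum S).
have us : uniq s by rewrite sort_uniq enum_uniq.
have ss : sorted (rle W) s by apply: sort_sorted; exact: rle_total.
have ms i : (i \in s) = (i \in S) by rewrite mem_sort mem_enum.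
(* The tie-break by index makes [rle] antisymmetric, so a prefix of the sorted list is exactly a
   [below] set, even among equal posteriors. *)
have takeE k0 n : (n < size s)%N -> take n.+1 s =i below S W (nth k0 s n).
  move=> ns i; rewrite in_take_leq// !inE -ms ltnS.
  have [iS|iS] /= := boolP (i \in s); last by rewrite leqNgt (leq_trans ns)// leqNgt index_mem.
  rewrite -{2}(nth_index k0 iS); apply/idP/idP => [iln|].
    by apply: (sorted_leq_nth (@rle_trans W) (@rle_refl W)); rewrite ?inE ?index_mem.
  have [//|nli] := leqP (index i s) n => ik.
  have/(_ n (index i s)) := sorted_ltn_nth (@rle_trans W) k0 ss.
  rewrite !inE index_mem => /(_ ns iS nli) => ki.
  have /(congr1 (index^~ s)) := @rle_anti W _ _ (introT andP (conj ik ki)).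
  by rewrite !index_uniq ?index_mem// => e; rewrite e ltnn in nli.
have sumE k0 n : (n < size s)%N ->
  ((\sum_(i <- take n.+1 s) W i) / n.+1%:R <= alpha) =
  (excess (below S W (nth k0 s n)) W <= 0).
  move=> ns; rewrite ler_pdivrMr ?ltr0n// /excess sumrB subr_le0 -(eq_bigl _ _ (takeE k0 n ns)).
  rewrite -(eq_bigl _ _ (takeE k0 n ns)) -!big_uniq ?take_uniq//=.
  by rewrite big_const_seq iter_addr_0 count_predT size_takel// mulr_natr.
set n := (\max_(_ < _ | _) _)%N.
have [kS|kS] /= := boolP (k \in S); last first.
  by apply/negP => /mem_take; rewrite ms (negbTE kS).
have ks : k \in s by rewrite ms.
have ils : (index k s < size s)%N by rewrite index_mem.
have memt m : k \in take m s = (index k s < m)%N by exact: in_take.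
rewrite memt; apply/idP/idP => [|ek].
  rewrite ltnNge => /negP nk.
  have [m mP km] : exists2 m : 'I_(size s).+1,
      (if m == 0 :> nat then 0 else (\sum_(i <- take m s) W i) / m%:R) <= alpha & (index k s < m)%N.
    apply: contrapT => hm; apply: nk; apply/bigmax_leqP => m mP.
    by rewrite leqNgt; apply/negP => km; apply: hm; exists m.
  have : (0 < m)%N by rewrite (leq_ltn_trans _ km).
  case: m mP km => -[//|m] /= ms' mP km _; rewrite ltnS in km.
  rewrite ltnS in ms'; rewrite (sumE k) // in mP.
  apply: excess_below_mono mP; first by rewrite -ms mem_nth.
  rewrite -{1}(nth_index k ks).
  by apply: (sorted_leq_nth (@rle_trans W) (@rle_refl W)) => //; rewrite inE.
have ils' : ((index k s).+1 < (size s).+1)%N by rewrite ltnS.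
apply: (@leq_trans (Ordinal ils')) => //.
by apply: (leq_bigmax_cond (Ordinal ils')) => /=; rewrite (sumE k) ?nth_index.
Qed.

Lemma rule_sub S W : rule alpha S W \subset S.
Proof. by apply/fintype.subsetP => k; rewrite rule_le => /andP[]. Qed.

Lemma eq_rule S W W' : {in S, W =1 W'} -> rule alpha S W = rule alpha S W'.
Proof.
move=> e; apply/setP => k; rewrite !rule_le; have [kS|//] /= := boolP (k \in S).
have -> : below S W k = below S W' k.
  by apply/setP => j; rewrite !inE; have [jS|//] /= := boolP (j \in S); rewrite /rle !e.
by congr (_ <= _); apply: eq_bigr => i; rewrite inE => /andP[iS _]; rewrite e.
Qed.

Lemma rule_prefix S W j k : j \in S -> k \in rule alpha S W -> rle W j k ->
  j \in rule alpha S W.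
Proof. by move=> jS; rewrite !rule_le jS => /andP[kS ek] jk; exact: excess_below_mono ek. Qed.

Lemma rle_max W B k0 : k0 \in B -> exists2 k, k \in B & {in B, forall i, rle W i k}.
Proof.
move=> Bk0.
have := extremumP (ord := fun i j => rle W j i) (P := mem B) id (@rle_refl W)
  (fun j i k ij jk => @rle_trans W _ _ _ jk ij) (fun i j => rle_total W j i) Bk0.
by case => k kB kmax; exists k.
Qed.

Lemma rle_min W B k0 : k0 \in B -> exists2 k, k \in B & {in B, forall i, rle W k i}.
Proof.
move=> Bk0.
have := extremumP (P := mem B) id (@rle_refl W) (@rle_trans W) (@rle_total W) Bk0.
by case => k kB kmin; exists k.
Qed.

Lemma excess_rule S W : excess (rule alpha S W) W <= 0.
Proof.
have [->|[k0 k0r]] := set_0Vmem (rule alpha S W); first by rewrite /excess big_set0.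
have [k kr kmax] := rle_max W k0r.
have := kr; rewrite rule_le => /andP[kS].
suff -> : below S W k = rule alpha S W by [].
apply/setP => j; rewrite inE; apply/andP/idP => [[jS]|jr]; first exact: rule_prefix.
by split; [apply: (fintype.subsetP (rule_sub S W)) | exact: kmax].
Qed.

(** Exchange argument. Let [k] be the first rejected stream and [B] the selection together with [k],
    whose excess is positive. If [Z] were larger than the selection, [B :\: Z] would have no more
    elements than [Z :\: B]; the former have posteriors at most [W k], the latter at least [W k],
    and [W k] exceeds [alpha]. So the excess of [Z] would be positive too. *)
Lemma card_rule_max S W Z : Z \subset S -> excess Z W <= 0 -> (#|Z| <= #|rule alpha S W|)%N.
Proof.
move=> ZS eZ; rewrite leqNgt; apply/negP => rZ.
have [k0 k0r] : exists k0, k0 \in S :\: rule alpha S W.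
  apply/set0Pn; rewrite finset.setD_eq0; apply: contraTN rZ => /(fintype.subset_trans ZS) Zr.
  by rewrite -leqNgt subset_leq_card.
have [k + kmin] := rle_min W k0r; rewrite finset.in_setD => /andP[kr kS].
have kP j : j \in S -> (j \in rule alpha S W) || (rle W k j).
  move=> jS; have [//|/= jr] := boolP (j \in rule alpha S W).
  by apply: kmin; rewrite finset.in_setD jr.
set B := below S W k.
have BE : B = k |: rule alpha S W.
  apply/setP => j; rewrite finset.in_setU1 inE; apply/andP/orP => [[jS jk]|[/eqP->|jr]].
  - have [|kj] := orP (kP j jS); [by right|left].
    by apply/eqP/(@rle_anti W); rewrite jk kj.
  - by rewrite kS rle_refl.
  - have jS := fintype.subsetP (rule_sub S W) _ jr; split => //.
    by have [//|kj] := orP (rle_total W j k); case/negP: kr; exact: rule_prefix kj.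
have eB : 0 < excess B W by move: kr; rewrite rule_le kS /= -ltNge.
have ak : alpha < W k by apply: excess_gt0 eB => i; rewrite inE => /andP[_ /rle_le].
have BZ : (#|B :\: Z| <= #|Z :\: B|)%N.
  by rewrite -(leq_add2l #|B :&: Z|) cardsID finset.setIC cardsID BE cardsU1 kr.
have : excess B W <= excess Z W; last first.
  by move=> /le_trans/(_ eZ); rewrite leNgt eB.
rewrite /excess (big_setID Z) [leRHS](big_setID B) /= finset.setIC lerD2l.
apply: (@le_trans _ _ ((W k - alpha) *+ #|B :\: Z|)).
  rewrite -sumr_const; apply: ler_sum => i; rewrite !inE => /andP[_ /andP[_ /rle_le]].
  by rewrite lerD2r.
apply: (@le_trans _ _ ((W k - alpha) *+ #|Z :\: B|)).
  by rewrite ler_pMn2l// subr_gt0.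
rewrite -sumr_const; apply: ler_sum => i; rewrite !inE lerD2r => /andP[+ iZ].
have iS := fintype.subsetP ZS _ iZ; rewrite iS /= => ik.
by have := rle_total W i k; rewrite (negbTE ik) => /rle_le.
Qed.

(** A permutation of all streams rather than an injection on [D]: it can be corrected by
    transpositions, and it can relabel the list of all streams. *)
Definition dominated (D S : {set 'I_K}) (v w : 'I_K -> R) (s : {perm 'I_K}) :=
  [forall i in D, (s i \in S) && (w (s i) <= v i)].

Lemma dominatedP (D S : {set 'I_K}) (v w : 'I_K -> R) (s : {perm 'I_K}) :
  reflect ({in D, forall i, s i \in S /\ w (s i) <= v i}) (dominated D S v w s).
Proof.
by apply: (iffP forall_inP) => h i iD; apply/andP; have := h i iD.
Qed.

(* Among the witnesses of domination, one that sends the most elements of [D] into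
   the selection of the rule sends all of them there: a missed element could be
   redirected to a free selected stream, whose posterior is no larger. *)
Lemma dominated_rule (D S : {set 'I_K}) (v w : 'I_K -> R) (s : {perm 'I_K}) :
  dominated D S v w s -> excess D v <= 0 ->
  exists s', dominated D (rule alpha S w) v w s'.
Proof.
move=> sP eD; have sD := elimT (dominatedP D S v w s) sP; set r := rule alpha S w.
have Dr : (#|D| <= #|r|)%N.
  rewrite -(card_imset D (@perm_inj _ s)); apply: card_rule_max.
    by apply/fintype.subsetP => _ /imsetP[i iD ->]; have [] := sD i iD.
  rewrite /excess big_imset /=; last by move=> i j _ _; exact: perm_inj.
  apply: le_trans eD; apply: ler_sum => i iD; rewrite lerD2r.
  by have [] := sD i iD.
have [s' s'P s'max] := arg_maxnP (fun s' : {perm 'I_K} => #|[set i in D | s' i \in r]|) sP.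
exists s'; apply/dominatedP => i iD; have s'D := elimT (dominatedP D S v w s') s'P.
split; last by have [] := s'D i iD.
apply: contraT => ir.
have [b br bD] : exists2 b, b \in r & b \notin s' @: D.
  apply/subsetPn; apply: contraTN Dr => rD; rewrite -ltnNge.
  rewrite -(card_imset D (@perm_inj _ s')); apply: proper_card.
  apply/properP; split => //; exists (s' i) => //; exact: imset_f.
set s2 := (s' * tperm (s' i) b)%g.
have s2i : s2 i = b by rewrite permM tpermL.
have s2j j : j \in D -> j != i -> s2 j = s' j.
  move=> jD ji; rewrite permM tpermD//; first by rewrite (inj_eq perm_inj) eq_sym.
  by apply: contraNneq bD => ->; exact: imset_f.
have s2P : dominated D S v w s2.
  apply/dominatedP => j jD; have [->|ji] := eqVneq j i; last by rewrite s2j//; exact: s'D.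
  rewrite s2i; have [siS siv] := s'D i iD; split.
    exact: (fintype.subsetP (rule_sub S w)).
  apply: le_trans siv; have [/rle_le//|sib] := orP (rle_total w b (s' i)).
  by case/negP: ir; exact: rule_prefix sib.
have /= := s'max _ s2P; rewrite leqNgt => /negP; case; apply: proper_card.
apply/properP; split.
  apply/fintype.subsetP => j; rewrite 2!(finset.in_set (fun _ => _ && _)) => /andP[jD jr]; rewrite jD s2j//.
  by apply: contraNneq ir => <-.
by exists i; rewrite (finset.in_set (fun _ => _ && _)) iD ?s2i// (negbTE ir).
Qed.

End Rule.

(** * Densities and the Bayes update *)

Local Open Scope classical_set_scope.

Section Density.
Local Open Scope ereal_scope.
Context {d : measure_display} {T : measurableType d} {R : realType}.
Variables (mu : {measure set T -> \bar R}) (f : T -> R).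
Hypotheses (mf : measurable_fun setT f) (f0 : forall x, (0 <= f x)%R).

(** The two proofs are arguments so that the measure structure can be attached to the term
    itself. *)
Definition density (_ : measurable_fun setT f) (_ : forall x, (0 <= f x)%R)
  (A : set T) : \bar R := \int[mu]_(x in A) (f x)%:E.

Let density_set0 : density mf f0 set0 = 0.
Proof. exact: integral_set0. Qed.

Let density_ge0 A : 0 <= density mf f0 A.
Proof. by apply: integral_ge0 => x _; rewrite lee_fin. Qed.

Let density_sigma_additive : semi_sigma_additive (density mf f0).
Proof.
move=> F mF tF mUF; rewrite /density ge0_integral_bigcup//.
- by apply: is_cvg_nneseries => n _ _; exact: density_ge0.
- by apply/measurable_EFinP; exact: measurable_funS mf.
- by move=> x _; rewrite lee_fin.
Qed.

HB.instance Definition _ := isMeasure.Build _ _ _ (density mf f0)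
  density_set0 density_ge0 density_sigma_additive.

Import HBNNSimple.

Let integral_density_nnsfun (h : {nnsfun T >-> R}) :
  \int[density mf f0]_x (h x)%:E = \int[mu]_x ((h x)%:E * (f x)%:E).
Proof.
have mind y : measurable_fun setT (fun x => (y * \1_(h @^-1` [set y]) x)%:E).
  by apply/measurable_EFinP; exact: measurable_funM.
rewrite integralT_nnsfun sintegralE.
transitivity (\int[mu]_x \sum_(y \in range h)
    ((y * \1_(h @^-1` [set y]) x)%:E * (f x)%:E)); last first.
  apply: eq_integral => x _; rewrite -ge0_mule_fsuml => [|y]; last exact: nnfun_muleindic_ge0.
  by rewrite fsumEFin// -fimfunE.
rewrite ge0_integral_fsum//; last 2 first.
- by move=> y; apply: emeasurable_funM => //; exact/measurable_EFinP.
- by move=> y x _; rewrite mule_ge0 ?nnfun_muleindic_ge0// lee_fin.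
apply: eq_fsbigr => _ /[!inE] -[z _ <-].
under eq_integral do rewrite EFinM -muleA.
rewrite ge0_integralZl_EFin//; last 2 first.
- by move=> x _; rewrite mule_ge0 ?lee_fin.
- by apply: emeasurable_funM; exact/measurable_EFinP.
congr (_ * _); rewrite /= /density integral_mkcond; apply: eq_integral => x _.
rewrite patchE indicE; case: ifPn; rewrite ?mul1e ?mul0e//.
Qed.

Lemma integral_density (g : T -> \bar R) : measurable_fun setT g -> (forall x, 0 <= g x) ->
  \int[density mf f0]_x g x = \int[mu]_x (g x * (f x)%:E).
Proof.
move=> mg g0; pose h := nnsfun_approx measurableT mg.
have gh x : g x = lim ((h n x)%:E @[n --> \oo]).
  by apply/esym/cvg_lim => //; apply: cvg_nnsfun_approx.
transitivity (\int[density mf f0]_x lim ((h n x)%:E @[n --> \oo])).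
  by apply: eq_integral => x _; exact: gh.
rewrite monotone_convergence//; last 3 first.
- by move=> n; exact/measurable_EFinP.
- by move=> n x _; rewrite lee_fin.
- by move=> x _ a b ab; rewrite lee_fin; exact/lefP/nd_nnsfun_approx.
under eq_fun do rewrite integral_density_nnsfun.
rewrite -monotone_convergence//; last 3 first.
- by move=> n; apply: emeasurable_funM; exact/measurable_EFinP.
- by move=> n x _; rewrite mule_ge0 ?lee_fin.
- by move=> x _ a b ab; rewrite lee_wpmul2r ?lee_fin//; exact/lefP/nd_nnsfun_approx.
apply: eq_integral => x _; apply/cvg_lim => //; apply: cvgeZr => //.
by apply: cvg_nnsfun_approx.
Qed.

End Density.

Lemma pi_measure_unique {d} {T : measurableType d} {R : realType} (G : set (set T))
    (m1 m2 : {measure set T -> \bar R}) :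
  G `<=` measurable -> setI_closed G -> G setT -> (m1 setT < +oo)%E ->
  (forall A, G A -> m1 A = m2 A) -> forall A, <<s G >> A -> m1 A = m2 A.
Proof.
move=> mG GI GT m1T m12; apply: (g_sigma_algebra_measure_unique G _ (fun=> setT)) => //.
by rewrite bigcup_const.
Qed.

Section Bayes.
Context {Xs : Type} {R : realType} (p q : Xs -> R) (theta : R).
Hypotheses (p0 : forall x, 0 <= p x) (q0 : forall x, 0 <= q x).

(* The probability of a change before the next observation, from the posterior
   [v]; the clipping makes it a probability for every real [v]. *)
Definition prior (v : R) : R := Num.max 0 (Num.min 1 (v + (1 - v) * theta)).

(** Predictive density of the next observation, [u] being the probability that the change precedes
    it. *)
Definition mixture (u : R) (x : Xs) : R := u * q x + (1 - u) * p x.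

(** Bayes' formula; it is 0 where the predictive density vanishes. *)
Definition posterior (u : R) (x : Xs) : R := u * q x / mixture u x.

Lemma prior_ge0 v : 0 <= prior v.
Proof. by rewrite /prior le_max lexx. Qed.

Lemma prior_le1 v : prior v <= 1.
Proof. by rewrite /prior ge_max ler01 ge_min lexx. Qed.

Lemma prior_itv v : 0 <= prior v <= 1.
Proof. by rewrite prior_ge0 prior_le1. Qed.

Lemma prior_mono (v w : R) : theta <= 1 -> v <= w -> prior v <= prior w.
Proof.
move=> t1 vw; apply: le_max2 => //; apply: le_min2 => //.
have : 0 <= (1 - theta) * (w - v) by rewrite mulr_ge0// subr_ge0.
by lra.
Qed.

Lemma prior_id v : 0 <= v <= 1 -> 0 <= theta <= 1 -> prior v = v + (1 - v) * theta.
Proof.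
move=> /andP[v0 v1] /andP[t0 t1]; rewrite /prior min_r; last by nra.
by rewrite max_r//; nra.
Qed.

Lemma mixture_ge0 u x : 0 <= u <= 1 -> 0 <= mixture u x.
Proof.
by move=> /andP[u0 u1]; rewrite addr_ge0 ?mulr_ge0 ?subr_ge0.
Qed.

(** Holds also where the mixture vanishes, because its two nonnegative terms then vanish. *)
Lemma posteriorM u x : 0 <= u <= 1 -> posterior u x * mixture u x = u * q x.
Proof.
move=> /andP[u0 u1]; rewrite /posterior; have [m0|m0] := eqVneq (mixture u x) 0; last by rewrite divfK.
rewrite m0 mulr0; have := m0; rewrite /mixture => /eqP.
by rewrite paddr_eq0 ?mulr_ge0 ?subr_ge0// => /andP[/eqP-> _].
Qed.

Lemma posteriorC u x : 0 <= u <= 1 -> (1 - posterior u x) * mixture u x = (1 - u) * p x.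
Proof. by move=> u01; rewrite mulrBl posteriorM// mul1r /mixture; ring. Qed.

Lemma posterior_itv u x : 0 <= u <= 1 -> 0 <= posterior u x <= 1.
Proof.
move=> u01; have /andP[u0 u1] := u01; have m0 := mixture_ge0 x u01; apply/andP; split.
  by rewrite divr_ge0 ?mulr_ge0.
have [e|n] := eqVneq (mixture u x) 0; first by rewrite /posterior e invr0 mulr0.
rewrite ler_pdivrMr ?lt_def ?n// mul1r /mixture lerDl mulr_ge0// subr_ge0//.
Qed.

Lemma posterior_mono (u w : R) x : 0 <= u <= 1 -> 0 <= w <= 1 -> u <= w ->
  posterior u x <= posterior w x.
Proof.
move=> u01 w01 uw; have /andP[u0 u1] := u01; have /andP[w0 w1] := w01.
have mu := mixture_ge0 x u01; have mw := mixture_ge0 x w01.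
have qx := q0 x; have px := p0 x.
have [eu|nu] := eqVneq (mixture u x) 0.
  by rewrite {1}/posterior eu invr0 mulr0; have /andP[] := posterior_itv x w01.
have [ew|nw] := eqVneq (mixture w x) 0.
  have : u * q x = 0.
    have : w * q x = 0 by rewrite -posteriorM// ew mulr0.
    move=> /eqP; rewrite mulf_eq0 => /orP[/eqP w00|/eqP->]; last by rewrite mulr0.
    have -> : u = 0 by apply/eqP; rewrite eq_le u0 -w00 uw.
    by rewrite mul0r.
  rewrite {1}/posterior => ->; rewrite mul0r.
  by have /andP[] := posterior_itv x w01.
rewrite /posterior ler_pdivrMr ?lt_def ?nu// mulrAC ler_pdivlMr ?lt_def ?nw//.
rewrite /mixture.
have : 0 <= (w - u) * (q x * p x) by rewrite mulr_ge0 ?subr_ge0// mulr_ge0.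
by lra.
Qed.

(* The sign of [posterior u x - u] is that of [q x - p x]. *)
Lemma posterior_gt (u : R) x : 0 <= u <= 1 -> p x <= q x -> q x = 0 \/ u <= posterior u x.
Proof.
move=> u01 pq; have /andP[u0 u1] := u01; have [|qn] := eqVneq (q x) 0; [by left|right].
have qx : 0 < q x by rewrite lt_def qn q0.
have [e|n] := eqVneq (mixture u x) 0.
  have := posteriorM x u01; rewrite e mulr0 => /esym/eqP.
  rewrite mulf_eq0 (negbTE qn) orbF => /eqP ->.
  by rewrite /posterior !mul0r.
rewrite /posterior ler_pdivlMr ?lt_def ?n ?mixture_ge0//.
rewrite ler_wpM2l// /mixture; have : 0 <= (1 - u) * (q x - p x).
  by rewrite mulr_ge0// subr_ge0.
by lra.
Qed.

Lemma posterior_lt u x : 0 <= u <= 1 -> q x <= p x -> posterior u x <= u.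
Proof.
move=> u01 pq; have /andP[u0 u1] := u01.
have [e|n] := eqVneq (mixture u x) 0; first by rewrite /posterior e invr0 mulr0.
rewrite /posterior ler_pdivrMr ?lt_def ?n ?mixture_ge0//.
rewrite ler_wpM2l// /mixture; have : 0 <= (1 - u) * (p x - q x).
  by rewrite mulr_ge0// subr_ge0.
by lra.
Qed.

(** Pointwise core of the stochastic monotonicity. The difference of the two sides is [(w - u) * ((q
    x - p x) * (f u - f (posterior u x)))]; the posterior moves in the direction of [q x - p x] and
    [f] is nonincreasing, so the last two factors have the same sign. *)
Lemma nonincreasing_mixture (f : R -> R) (u w : R) x : 0 <= u <= 1 -> u <= w ->
  (forall a b, a <= b -> f b <= f a) ->
  f (posterior u x) * mixture w x + (w - u) * f u * p x <=
  f (posterior u x) * mixture u x + (w - u) * f u * q x.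
Proof.
move=> u01 uw fd; rewrite -subr_ge0.
have -> : f (posterior u x) * mixture u x + (w - u) * f u * q x -
    (f (posterior u x) * mixture w x + (w - u) * f u * p x) =
    (w - u) * ((q x - p x) * (f u - f (posterior u x))).
  by rewrite /mixture; ring.
rewrite mulr_ge0 ?subr_ge0//.
have [pq|qp] := leP (p x) (q x).
  have [q00|/fd h] := posterior_gt u01 pq; last by rewrite mulr_ge0 ?subr_ge0.
  have -> : p x = 0 by apply/eqP; rewrite eq_le p0 -q00 pq.
  by rewrite q00 subrr mul0r.
by rewrite mulr_le0 ?subr_le0 ?fd ?posterior_lt// ltW.
Qed.

End Bayes.

Section MeasurableBayes.
Context {dX : measure_display} {Xs : measurableType dX} {R : realType} (p q : Xs -> R) (theta : R).
Hypotheses (p0 : forall x, 0 <= p x) (q0 : forall x, 0 <= q x).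
Hypotheses (mp : measurable_fun setT p) (mq : measurable_fun setT q).
Context {d : measure_display} {T : measurableType d}.

Lemma measurable_prior (D : set T) (f : T -> R) : measurable_fun D f ->
  measurable_fun D (fun w => prior theta (f w)).
Proof.
move=> mf; apply: measurable_maxr => //; apply: measurable_minr => //.
apply: measurable_funD => //; apply: measurable_funM => //.
exact: measurable_funB.
Qed.

Lemma measurable_mixture (D : set T) (f : T -> R) (Y : T -> Xs) :
  measurable_fun D f -> measurable_fun D Y ->
  measurable_fun D (fun w => mixture p q (f w) (Y w)).
Proof.
move=> mf mY; apply: measurable_funD; apply: measurable_funM => //.
- exact: measurableT_comp mY.
- exact: measurable_funB.
- exact: measurableT_comp mY.
Qed.

Lemma measurable_posterior (D : set T) (f : T -> R) (Y : T -> Xs) :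
  (forall w, 0 <= f w <= 1) -> measurable_fun D f -> measurable_fun D Y ->
  measurable_fun D (fun w => posterior p q (f w) (Y w)).
Proof.
move=> f01 mf mY; apply: measurable_funM.
  by apply: measurable_funM => //; exact: measurableT_comp mY.
(* The mixture is nonnegative, and there the inverse, including that of 0, is the power with
   exponent -1. *)
rewrite (_ : (fun _ => _) = (fun w => (mixture p q (f w) (Y w)) `^ (-1))); last first.
  by apply/funext => w; rewrite powR_inv1// mixture_ge0.
apply: (measurableT_comp (@measurable_powR R (-1))).
exact: measurable_mixture.
Qed.

End MeasurableBayes.

Section Update.
Context {I : eqType} {R : Type}.

Definition update (v : I -> R) (k : I) (a : R) : I -> R :=
  fun j => if j == k then a else v j.

Lemma update_same v k a : update v k a k = a.
Proof. by rewrite /update eqxx. Qed.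

Lemma update_other v k a j : j != k -> update v k a j = v j.
Proof. by rewrite /update => /negbTE ->. Qed.

Lemma updateC v j k a b : j != k ->
  update (update v j a) k b = update (update v k b) j a.
Proof.
by move=> jk; apply/funext => i; rewrite /update; case: eqVneq => // ->; rewrite eq_sym (negbTE jk).
Qed.

End Update.

(* Measurability of a function of finitely many real variables, phrased so as
   to avoid a sigma-algebra on the function space. *)
Definition cmeasurable {R : realType} {K : nat} (h : ('I_K -> R) -> \bar R) : Prop :=
  forall d (T : measurableType d) (f : 'I_K -> T -> R),
    (forall k, measurable_fun setT (f k)) -> measurable_fun setT (fun w => h (f^~ w)).

(** * Averaging a function of the posteriors over new observations *)

Section Transition.
Context {dX : measure_display} {Xs : measurableType dX} {R : realType}.
Variables (rho : {finite_measure set Xs -> \bar R}) (p q : Xs -> R) (theta : R).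
Hypotheses (p0 : forall x, 0 <= p x) (q0 : forall x, 0 <= q x).
Hypotheses (mp : measurable_fun setT p) (mq : measurable_fun setT q).
Hypotheses (p1 : (\int[rho]_x (p x)%:E = 1)%E) (q1 : (\int[rho]_x (q x)%:E = 1)%E).
Hypothesis (theta1 : theta <= 1).
Context {K : nat}.
Implicit Types (h : ('I_K -> R) -> \bar R) (v : 'I_K -> R) (k j : 'I_K).

Let mix := mixture p q.
Let post := posterior p q.

(* The conditional expectation of [h] after one more observation of stream [k],
   [v] being the posteriors before it. *)
Definition observe k h v : \bar R :=
  (\int[rho]_x (h (update v k (post (prior theta (v k)) x)) *
                (mix (prior theta (v k)) x)%:E))%E.

(** The head of [l] is the most recent observation, hence the first to be integrated out. *)
Definition observe_seq (l : seq 'I_K) h : ('I_K -> R) -> \bar R :=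
  foldl (fun g k => observe k g) h l.

Definition nice (C : R) h := cmeasurable h /\ forall v, (0 <= h v <= C%:E)%E.

Let mixE0 (u : R) x : 0 <= u <= 1 -> (0 <= (mix u x)%:E)%E.
Proof. by move=> u01; rewrite lee_fin mixture_ge0. Qed.

Let mmix u : measurable_fun setT (mix u).
Proof. exact: measurable_mixture. Qed.

Lemma integral_mixture (u : R) : 0 <= u <= 1 -> (\int[rho]_x (mix u x)%:E = 1)%E.
Proof.
move=> /andP[u0 u1]; rewrite /mix /mixture.
under eq_integral do rewrite EFinD EFinM [X in (_ + X)%E]EFinM.
have mZ (c : R) f : measurable_fun setT f -> measurable_fun setT (fun x : Xs => (c%:E * (f x)%:E)%E).
  by move=> mf; apply/measurable_EFinP; exact: measurable_funM.
rewrite ge0_integralD//; last 4 first.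
- by move=> x _; rewrite mule_ge0 ?lee_fin.
- exact: mZ.
- by move=> x _; rewrite mule_ge0 ?lee_fin ?subr_ge0.
- exact: mZ.
have p0E x : setT x -> (0 <= (p x)%:E)%E by rewrite lee_fin.
have q0E x : setT x -> (0 <= (q x)%:E)%E by rewrite lee_fin.
rewrite !ge0_integralZl_EFin ?subr_ge0//; try exact/measurable_EFinP.
by rewrite p1 q1 !mule1 -EFinD subrKC.
Qed.

Section Integrand.
Context {d : measure_display} {T : measurableType d} (f : 'I_K -> T -> R) (h : ('I_K -> R) -> \bar R) (k : 'I_K).
Hypotheses (mh : cmeasurable h) (mf : forall j, measurable_fun setT (f j)).

Lemma measurable_observe_integrand (Y : T -> Xs) : measurable_fun setT Y ->
  measurable_fun setT (fun w =>
    (h (update (f^~ w) k (post (prior theta (f k w)) (Y w))) *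
     (mix (prior theta (f k w)) (Y w))%:E)%E).
Proof.
move=> mY; apply: emeasurable_funM.
  pose g j (w : T) := if j == k then post (prior theta (f k w)) (Y w) else f j w.
  apply: (mh (f := g)) => j; rewrite /g; case: (_ == _) => //.
  apply: measurable_posterior => // [w|]; first exact: prior_itv.
  exact: measurable_prior.
by apply/measurable_EFinP; apply: measurable_mixture => //; exact: measurable_prior.
Qed.

End Integrand.

Lemma observe_ge0 k h v : (forall w, (0 <= h w)%E) -> (0 <= observe k h v)%E.
Proof.
by move=> h0; apply: integral_ge0 => x _; rewrite mule_ge0// mixE0// prior_itv.
Qed.

Let mobserve_x h k v : cmeasurable h -> measurable_fun setT (fun x =>
  (h (update v k (post (prior theta (v k)) x)) * (mix (prior theta (v k)) x)%:E)%E).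
Proof.
move=> mh; apply: (measurable_observe_integrand (f := fun j _ => v j)) => //.
Qed.

Lemma observe_cmeasurable k h : cmeasurable h -> (forall w, (0 <= h w)%E) -> cmeasurable (observe k h).
Proof.
move=> mh h0 d T f mf.
pose F (z : T * Xs) := (h (update (f^~ z.1) k (post (prior theta (f k z.1)) z.2)) *
   (mix (prior theta (f k z.1)) z.2)%:E)%E.
apply: (measurable_fun_fubini_tonelli_F (m2 := rho) F) => [|z].
  apply: (measurable_observe_integrand (f := fun j z => f j z.1)) => // j.
  exact: measurableT_comp.
by rewrite mule_ge0// mixE0// prior_itv.
Qed.

Lemma observe_cst k (c : \bar R) v : (0 <= c)%E -> observe k (fun=> c) v = c.
Proof.
move=> c0; rewrite /observe ge0_integralZl//.
- by rewrite integral_mixture ?mule1// prior_itv.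
- exact/measurable_EFinP.
- by move=> x _; rewrite mixE0// prior_itv.
Qed.

Lemma nice_observe C k h : nice C h -> nice C (observe k h).
Proof.
move=> [mh hC]; have h0 w : (0 <= h w)%E by have /andP[] := hC w.
split; first exact: observe_cmeasurable.
move=> v; rewrite observe_ge0//=.
have C0 : (0 <= C%:E)%E by have /andP[] := hC v; exact: le_trans.
rewrite -[leRHS](@observe_cst k _ v)//; apply: ge0_le_integral => //.
- by move=> x _; rewrite mule_ge0// mixE0// prior_itv.
- exact: mobserve_x.
- exact: (@mobserve_x (fun=> C%:E)).
- by move=> x _; rewrite lee_wpmul2r ?mixE0 ?prior_itv//; have /andP[] := hC (update v k (post (prior theta (v k)) x)).
Qed.

Lemma nice_observe_seq C l h : nice C h -> nice C (observe_seq l h).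
Proof. by elim: l h => //= k l IH h /(nice_observe k)/IH. Qed.

(** For distinct streams the two updates act on different coordinates, and the claim is Tonelli's
    theorem. *)
Lemma observeC C j k h : nice C h -> observe j (observe k h) = observe k (observe j h).
Proof.
have [->//|jk] := eqVneq j k.
move=> [mh hC]; have h0 w : (0 <= h w)%E by have /andP[] := hC w.
apply/funext => v; rewrite /observe.
pose F (z : Xs * Xs) : \bar R :=
  (h (update (update v j (post (prior theta (v j)) z.1)) k (post (prior theta (v k)) z.2)) *
   (mix (prior theta (v k)) z.2)%:E * (mix (prior theta (v j)) z.1)%:E)%E.
have F0 z : (0 <= F z)%E by rewrite !mule_ge0 ?mixE0 ?prior_itv.
have mF : measurable_fun setT F.
  apply: emeasurable_funM; last first.
    by apply/measurable_EFinP; exact: measurableT_comp.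
  apply: emeasurable_funM; last first.
    by apply/measurable_EFinP; exact: measurableT_comp.
  pose g i (z : Xs * Xs) := if i == k then post (prior theta (v k)) z.2 else
    if i == j then post (prior theta (v j)) z.1 else v i.
  apply: (mh _ _ g) => i; rewrite /g; case: (i == k).
    by apply: measurable_posterior => // z; exact: prior_itv.
  case: (i == j) => //.
  by apply: measurable_posterior => // z; exact: prior_itv.
transitivity (\int[rho]_y \int[rho]_x F (y, x))%E.
  apply: eq_integral => y _; rewrite -ge0_integralZr//.
  - by rewrite update_other 1?eq_sym.
  - by apply: mobserve_x.
  - by move=> x _; rewrite mule_ge0// mixE0// prior_itv.
  - by rewrite mixE0// prior_itv.
rewrite (fubini_tonelli F)//; apply: eq_integral => x _.
rewrite -ge0_integralZr//.
- apply: eq_integral => y _; rewrite (update_other _ _ jk) /F/= updateC//.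
  by rewrite -!muleA [X in (_ * X)%E]muleC.
- by apply: mobserve_x.
- by move=> y _; rewrite mule_ge0// mixE0// prior_itv.
- by rewrite mixE0// prior_itv.
Qed.

Lemma observe_seqC C k l h : nice C h ->
  observe_seq l (observe k h) = observe k (observe_seq l h).
Proof.
elim: l h => //= j l IH h hC.
by rewrite (observeC _ _ hC) IH//; exact: nice_observe.
Qed.

Lemma observe_seq_perm C l1 l2 h : nice C h -> perm_eq l1 l2 ->
  observe_seq l1 h = observe_seq l2 h.
Proof.
move=> hC; elim: l1 l2 h hC => [|k l1 IH] l2 h hC.
  by move=> /perm_size/esym/size0nil ->.
move=> e; have kl2 : k \in l2 by rewrite -(perm_mem e) mem_head.
have rl2 : perm_eq l1 (rem k l2).
  by rewrite -(perm_cons k) (perm_trans e)// perm_to_rem.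
rewrite /= (IH (rem k l2)) ?(observe_seqC _ _ hC)//; last exact: nice_observe.
elim: l2 h hC kl2 {e rl2 IH} => //= j l2 IH h hC.
rewrite in_cons; case: eqVneq => [<- _|kj /= kl2].
  by rewrite (observe_seqC _ _ hC).
by rewrite IH//; exact: nice_observe.
Qed.

(** With [s = 1] and [h' = h] this says that [h] is nonincreasing in the coordinates in [D] and
    depends on no others. *)
Definition mono_rel (D : {set 'I_K}) (s : {perm 'I_K}) h h' :=
  forall v v', {in D, forall i, v' (s i) <= v i} -> (h v <= h' v')%E.

(* The terms [(w - u) * f u * p] and [(w - u) * f u * q] have the same integral;
   added to the two sides they reduce the claim to [nonincreasing_mixture]. *)
Lemma le_integral_mixture (f : R -> R) (u w : R) :
  0 <= u <= 1 -> 0 <= w <= 1 -> u <= w ->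
  (forall a, 0 <= f a) -> (forall a b, a <= b -> f b <= f a) ->
  (forall u : R, 0 <= u <= 1 -> measurable_fun setT (fun x => f (post u x))) ->
  (\int[rho]_x ((f (post w x))%:E * (mix w x)%:E) <=
   \int[rho]_x ((f (post u x))%:E * (mix u x)%:E))%E.
Proof.
move=> u01 w01 uw f0 fd mfp.
have mM u' w' : 0 <= u' <= 1 ->
    measurable_fun setT (fun x => ((f (post u' x))%:E * (mix w' x)%:E)%E).
  move=> u'01; apply: emeasurable_funM; last exact/measurable_EFinP.
  by apply/measurable_EFinP; exact: mfp.
have F0 u' w' x : 0 <= w' <= 1 -> (0 <= (f (post u' x))%:E * (mix w' x)%:E)%E.
  by move=> w'01; rewrite mule_ge0 ?mixE0// lee_fin.
apply: (@le_trans _ _ (\int[rho]_x ((f (post u x))%:E * (mix w x)%:E))%E).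
  apply: ge0_le_integral => //; [by move=> x _; exact: F0|exact: mM|exact: mM|].
  move=> x _; rewrite lee_wpmul2r ?mixE0// lee_fin.
  exact/fd/posterior_mono.
set c := (w - u) * f u; have c0 : 0 <= c by rewrite mulr_ge0// subr_ge0.
have cE (g : Xs -> R) : measurable_fun setT g -> (forall x, 0 <= g x) -> (\int[rho]_x (g x)%:E = 1)%E ->
    (\int[rho]_x (c%:E * (g x)%:E) = c%:E)%E.
  move=> mg g0 g1; rewrite ge0_integralZl_EFin ?g1 ?mule1//.
    by move=> x _; rewrite lee_fin.
  exact/measurable_EFinP.
rewrite -(@leeD2rE _ c%:E)// -[X in (_ + X <= _)%E](cE _ mp p0 p1).
rewrite -[X in (_ <= _ + X)%E](cE _ mq q0 q1).
have mc (g : Xs -> R) : measurable_fun setT g -> measurable_fun setT (fun x : Xs => (c%:E * (g x)%:E)%E).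
  by move=> mg; apply/measurable_EFinP; exact: measurable_funM.
rewrite -!ge0_integralD//; first last.
- exact: mc.
- by move=> x _; rewrite mule_ge0 ?lee_fin.
- exact: mM.
- by move=> x _; exact: F0.
- exact: mc.
- by move=> x _; rewrite mule_ge0 ?lee_fin.
- exact: mM.
- by move=> x _; exact: F0.
apply: ge0_le_integral => //.
- by move=> x _; rewrite adde_ge0 ?F0// mule_ge0 ?lee_fin.
- by apply: emeasurable_funD; [exact: mM|exact: mc].
- by apply: emeasurable_funD; [exact: mM|exact: mc].
- by move=> x _; rewrite -!EFinM -!EFinD lee_fin; exact: nonincreasing_mixture.
Qed.

Lemma observe_mono C k D (s : {perm 'I_K}) h h' : nice C h -> nice C h' ->
  mono_rel D 1%g h h -> mono_rel D s h h' ->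
  mono_rel D s (observe k h) (observe (s k) h').
Proof.
move=> nh nh' hh hh' v v' vv'.
have [mh hC] := nh; have [mh' hC'] := nh'.
have h0 w : (0 <= h w)%E by have /andP[] := hC w.
have h0' w : (0 <= h' w)%E by have /andP[] := hC' w.
have hfin w : ((fine (h w))%:E = h w)%E.
  rewrite fineK// ge0_fin_numE//; have /andP[_ /le_lt_trans] := hC w; apply.
  exact: ltry.
(* Outside [D] the coordinate [k] does not affect [h], so observing it leaves [h v] unchanged, while
   every value of [h'] that is averaged is at least [h v]. *)
have [kD|kD] := boolP (k \in D); last first.
  have hk a : h (update v k a) = h v.
    apply/eqP; rewrite eq_le; apply/andP; split; apply: hh => i iD; rewrite perm1.
      by rewrite update_other//; apply: contraNneq kD => <-.
    by rewrite update_other//; apply: contraNneq kD => <-.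
  have -> : observe k h v = h v.
    rewrite -[RHS](@observe_cst k _ v)//.
    by apply: eq_integral => x _; rewrite hk.
  rewrite -(@observe_cst (s k) (h v) v')//; apply: ge0_le_integral => //.
  - by move=> x _; rewrite mule_ge0// mixE0// prior_itv.
  - exact: (@mobserve_x (fun=> h v)).
  - exact: mobserve_x.
  - move=> x _; rewrite lee_wpmul2r ?mixE0 ?prior_itv//; apply: hh' => i iD.
    rewrite update_other ?vv'//; apply: contraNneq kD => /perm_inj <- //.
set u := prior theta (v k); set w := prior theta (v' (s k)).
have wu : w <= u by apply: prior_mono => //; exact: vv'.
pose f a := fine (h (update v k a)).
(* Intermediate term: still [h], but with stream [k] started from the smaller prior [w]. The first
   inequality is the stochastic monotonicity in one coordinate, the second compares [h] and [h'] at
   the same observation. *)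
apply: (@le_trans _ _ (\int[rho]_x ((f (post w x))%:E * (mix w x)%:E))%E).
  rewrite /observe -/u.
  under eq_integral do rewrite -hfin.
  apply: le_integral_mixture => //; rewrite ?prior_itv//.
  - by move=> a; rewrite fine_ge0.
  - move=> a b ab; rewrite fine_le//; try by rewrite -hfin.
    apply: hh => i iD; rewrite perm1 /update; case: ifP => //.
  - move=> u' u'01; apply: (measurableT_comp (@fine_measurable R setT measurableT)).
    pose g i x := if i == k then post u' x else v i.
    apply: (mh _ _ g) => i; rewrite /g; case: (_ == _) => //.
    exact: measurable_posterior.
apply: ge0_le_integral => //.
- by move=> x _; rewrite mule_ge0 ?mixE0 ?prior_itv// lee_fin fine_ge0.
- under eq_fun do rewrite hfin.
  apply: emeasurable_funM; last exact/measurable_EFinP.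
  pose g i x := if i == k then post w x else v i.
  apply: (mh _ _ g) => i; rewrite /g; case: (_ == _) => //.
  by apply: measurable_posterior => // x; exact: prior_itv.
- exact: mobserve_x.
- move=> x _; rewrite lee_wpmul2r ?mixE0 ?prior_itv// hfin; apply: hh' => i iD.
  rewrite /update (inj_eq perm_inj); case: ifP => // _; exact: vv'.
Qed.

Lemma observe_seq_mono C l D (s : {perm 'I_K}) h h' : nice C h -> nice C h' ->
  mono_rel D 1%g h h -> mono_rel D s h h' ->
  mono_rel D s (observe_seq l h) (observe_seq (map s l) h').
Proof.
elim: l h h' => //= k l IH h h' nh nh' hh hh'; apply: IH; try exact: nice_observe.
  by have := observe_mono k nh nh hh hh; rewrite perm1.
exact: (observe_mono k nh nh' hh hh').
Qed.

(** The list of all streams is its own image under [s] up to order, and order is irrelevant. This is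
    what is gained by observing every stream, active or not. *)
Lemma observe_enum_mono C D (s : {perm 'I_K}) h h' : nice C h -> nice C h' ->
  mono_rel D 1%g h h -> mono_rel D s h h' ->
  mono_rel D s (observe_seq (enum 'I_K) h) (observe_seq (enum 'I_K) h').
Proof.
move=> nh nh' hh hh'.
rewrite (observe_seq_perm (l1 := enum 'I_K) (l2 := map s (enum 'I_K)) nh'); last first.
  apply: uniq_perm; rewrite ?(map_inj_uniq (@perm_inj _ s)) ?enum_uniq//.
  by move=> i; rewrite mem_enum; apply/esym/mapP; exists (s^-1%g i); rewrite ?mem_enum// permKV.
exact: (observe_seq_mono _ nh nh' hh hh').
Qed.

End Transition.

(** * The expected utilization of the one-step rule *)

Section FiniteValued.
Context {d : measure_display} {T : measurableType d}.

Lemma measurable_set_eq {I : finType} (N : T -> {set I}) (r : {set I}) :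
  (forall k, measurable_fun setT (fun w => k \in N w)) -> measurable [set w | N w = r].
Proof.
move=> mN; pose b l w := all (fun k => (k \in N w) == (k \in r)) l.
have mb l : measurable_fun setT (b l).
  elim: l => [|k l IH]; first exact: measurable_cst.
  apply: measurable_and => //.
  case: (k \in r); first by under eq_fun do rewrite eqb_id; exact: mN.
  by under eq_fun do rewrite eqbF_neg; exact: measurable_neg.
rewrite (_ : [set w | _] = setT `&` b (enum I) @^-1` [set true]); first exact: mb.
rewrite setTI; apply/seteqP; split=> w /=.
  by move=> Nr; apply/allP => k _; rewrite Nr.
by move=> /allP h; apply/setP => k; apply/eqP/h; rewrite mem_enum.
Qed.

Lemma measurable_fun_switch {d'} {U : measurableType d'} {I : finType} (N : T -> I)
    (G : I -> T -> U) :
  (forall r, measurable [set w | N w = r]) -> (forall r, measurable_fun setT (G r)) ->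
  measurable_fun setT (fun w => G (N w) w).
Proof.
move=> mN mG _ Y mY.
rewrite (_ : _ `&` _ = \bigcup_(r in [set: I]) ([set w | N w = r] `&` (setT `&` G r @^-1` Y))).
  apply: fin_bigcup_measurable; first exact: finite_finset.
  by move=> r _; apply: measurableI => //; exact: mG.
rewrite setTI; apply/seteqP; split => w /=; last by move=> [r _ [<- [_ ]]].
by move=> GY; exists (N w) => //; split.
Qed.

Lemma measurable_in_rule {R : realType} {K : nat} (alpha : R) (f : 'I_K -> T -> R) (S : {set 'I_K}) k :
  (forall j, measurable_fun setT (f j)) ->
  measurable_fun setT (fun w => k \in rule alpha S (f^~ w)).
Proof.
move=> mf; under eq_fun do rewrite rule_le.
apply: measurable_and; first exact: measurable_cst.
rewrite (_ : (fun w => _) = (fun w =>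
    (\sum_(i <- enum S) if rle (f^~ w) i k then f i w - alpha else 0) <= 0)).
  apply: measurable_fun_ler; last exact: measurable_cst.
  apply: measurable_sum => i; apply: measurable_fun_ifT.
  - apply: measurable_or; first exact: measurable_fun_ltr.
    by apply: measurable_and; [exact: measurable_fun_eqr|exact: measurable_cst].
  - exact: measurable_funB.
  - exact: measurable_cst.
apply/funext => w; congr (_ <= _).
by rewrite big_enum -big_mkcondr; apply: eq_bigl => i; rewrite inE.
Qed.

Lemma measurable_rule {R : realType} {K : nat} (alpha : R) (f : 'I_K -> T -> R)
    (S : T -> {set 'I_K}) r :
  (forall s, measurable [set w | S w = s]) ->
  (forall j, measurable_fun setT (f j)) ->
  measurable [set w | rule alpha (S w) (f^~ w) = r].
Proof.
move=> mS mf; apply: measurable_set_eq => k.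
apply: (measurable_fun_switch (G := fun s w => k \in rule alpha s (f^~ w))) => // s.
exact: measurable_in_rule.
Qed.

End FiniteValued.

Section Value.
Context {dX : measure_display} {Xs : measurableType dX} {R : realType}.
Variables (rho : {finite_measure set Xs -> \bar R}) (p q : Xs -> R) (theta : R).
Hypotheses (p0 : forall x, 0 <= p x) (q0 : forall x, 0 <= q x).
Hypotheses (mp : measurable_fun setT p) (mq : measurable_fun setT q).
Hypotheses (p1 : (\int[rho]_x (p x)%:E = 1)%E) (q1 : (\int[rho]_x (q x)%:E = 1)%E).
Hypothesis (theta1 : theta <= 1).
Context {K : nat} (alpha : R).
Implicit Types (S D Z : {set 'I_K}) (v : 'I_K -> R).

Local Notation observe_all := (observe_seq rho p q theta (enum 'I_K)).

(* The expected utilization over the next [n] steps of the one-step rule, from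
   the active set [S] with posteriors [v]. *)
Fixpoint value n S v : \bar R :=
  if n is n'.+1 then
    (#|rule alpha S v|%:R%:E + observe_all (value n' (rule alpha S v)) v)%E
  else 0%E.

(** Here the next active set [S] is imposed, whereas in [value n.+1] the rule selects it. *)
Definition stage n S v : \bar R := (#|S|%:R%:E + observe_all (value n S) v)%E.

Lemma nice_value n S : nice (n * K)%:R (value n S).
Proof.
elim: n S => [|n IH] S.
  split; first by move=> d T f mf; exact: measurable_cst.
  by move=> v; rewrite mul0n !lexx.
have nS r : nice (n * K)%:R (observe_all (value n r)) by apply: nice_observe_seq.
split=> [d T f mf|v] /=.
  apply: (measurable_fun_switch (N := fun w => rule alpha S (f^~ w))
    (G := fun r w => (#|r|%:R%:E + observe_all (value n r) (f^~ w))%E)) => r.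
    by apply: measurable_set_eq => k; exact: measurable_in_rule.
  by apply: emeasurable_funD; [exact: measurable_cst|exact: (nS r).1].
have /andP[l u] := (nS (rule alpha S v)).2 v.
rewrite adde_ge0 ?lee_fin//= mulSn natrD EFinD leeD// lee_fin ler_nat.
by rewrite (leq_trans (max_card _))// card_ord.
Qed.

Let stage_mono_of n :
  (forall D S v w (s : {perm 'I_K}), dominated D S v w s -> (value n D v <= value n S w)%E) ->
  forall D S v w (s : {perm 'I_K}), dominated D S v w s -> (stage n D v <= stage n S w)%E.
Proof.
move=> IH D S v w s dDS; have dP := elimT (dominatedP D S v w s) dDS; apply: leeD.
  rewrite lee_fin ler_nat -(card_imset _ (@perm_inj _ s)); apply: subset_leq_card.
  by apply/fintype.subsetP => _ /imsetP[i iD ->]; have [] := dP i iD.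
apply: (observe_enum_mono p0 q0 mp mq p1 q1 theta1 (s := s) (nice_value n D) (nice_value n S)).
- move=> a b ab; apply: (IH _ _ _ _ 1%g); apply/dominatedP => i iD; rewrite perm1; split => //.
  by have := ab i iD; rewrite perm1.
- move=> a b ab; apply: (IH _ _ _ _ s); apply/dominatedP => i iD; split; last exact: ab.
  by have [] := dP i iD.
- by move=> i iD; have [] := dP i iD.
Qed.

Lemma value_mono n D S v w (s : {perm 'I_K}) :
  dominated D S v w s -> (value n D v <= value n S w)%E.
Proof.
elim: n D S v w s => [|n IH] D S v w s dDS /=; first exact: lexx.
have dr : dominated (rule alpha D v) S v w s.
  apply/dominatedP => i /(fintype.subsetP (rule_sub alpha D v)).
  exact: (elimT (dominatedP D S v w s) dDS).
have [s' ds'] := dominated_rule dr (excess_rule alpha D v).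
exact: (stage_mono_of IH ds').
Qed.

(** Bellman optimality of the rule. The identity embeds [Z] in [S], and [dominated_rule] turns it
    into a matching of [Z] into the selection. *)
Lemma stage_le_value n S Z v : Z \subset S -> excess alpha Z v <= 0 ->
  (stage n Z v <= value n.+1 S v)%E.
Proof.
move=> ZS eZ; have dZ : dominated Z S v v 1%g.
  by apply/dominatedP => i iZ; rewrite perm1 (fintype.subsetP ZS).
have [s ds] := dominated_rule dZ eZ.
exact: (stage_mono_of (@value_mono n) ds).
Qed.

End Value.

(** * The filter *)

(* Taking the densities relative to the finite measure [(p + q) mu] disposes of
   the possible lack of sigma-finiteness of [mu]. *)
Lemma finite_dominating_measure {d} {T : measurableType d} {R : realType}
    (mu : {measure set T -> \bar R}) (p q : T -> R) :
  (forall x, 0 <= p x) -> (forall x, 0 <= q x) ->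
  measurable_fun setT p -> measurable_fun setT q ->
  (\int[mu]_x (p x)%:E < +oo)%E -> (\int[mu]_x (q x)%:E < +oo)%E ->
  exists (rho : {finite_measure set T -> \bar R}) (p' q' : T -> R),
    [/\ forall x, 0 <= p' x, forall x, 0 <= q' x,
        measurable_fun setT p', measurable_fun setT q' &
        forall B, measurable B ->
          (\int[rho]_(x in B) (p' x)%:E = \int[mu]_(x in B) (p x)%:E)%E /\
          (\int[rho]_(x in B) (q' x)%:E = \int[mu]_(x in B) (q x)%:E)%E].
Proof.
move=> p0 q0 mp mq pfin qfin; pose f x := p x + q x.
have mf : measurable_fun setT f by exact: measurable_funD.
have f0 x : 0 <= f x by rewrite addr_ge0.
have fin : fin_num_fun (density mu mf f0).
  apply: lty_fin_num_fun; rewrite /= /density.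
  under eq_integral do rewrite EFinD.
  rewrite ge0_integralD//; last 4 first.
  - by move=> x _; rewrite lee_fin.
  - exact/measurable_EFinP.
  - by move=> x _; rewrite lee_fin.
  - exact/measurable_EFinP.
  exact: lte_add_pinfty.
pose fin_mixin := @Measure_isFinite.Build _ _ _ (density mu mf f0) fin.
pose rho : {finite_measure set T -> \bar R} := HB.pack (density mu mf f0) fin_mixin.
have mI : measurable_fun setT (fun x => (f x)^-1).
  rewrite (_ : (fun _ => _) = (fun x => (f x) `^ (-1))).
    exact: (measurableT_comp (@measurable_powR R (-1))).
  by apply/funext => x; rewrite powR_inv1.
(* Where [p + q] vanishes so do [p] and [q], hence the value of the quotient there is harmless. *)
have key (g : T -> R) : (forall x, 0 <= g x) -> measurable_fun setT g ->
    (forall x, f x = 0 -> g x = 0) -> forall B, measurable B ->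
    (\int[rho]_(x in B) (g x / f x)%:E = \int[mu]_(x in B) (g x)%:E)%E.
  move=> g0 mg gf B mB.
  transitivity (\int[mu]_x (((fun x => (g x / f x)%:E) \_ B) x * (f x)%:E))%E.
    rewrite [LHS]integral_mkcond; apply: integral_density.
      apply/(measurable_restrictT _ mB).1/measurable_funTS/measurable_EFinP.
      exact: measurable_funM.
    by move=> x; apply: erestrict_ge0 => y _; rewrite lee_fin divr_ge0.
  rewrite [RHS]integral_mkcond; apply: eq_integral => x _; rewrite !patchE.
  case: ifP => _; last by rewrite mul0e.
  have [/gf ->|fx] := eqVneq (f x) 0; first by rewrite mul0r mul0e.
  by rewrite -EFinM divfK.
exists rho, (fun x => p x / f x), (fun x => q x / f x); split.
- by move=> x; rewrite divr_ge0.
- by move=> x; rewrite divr_ge0.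
- exact: measurable_funM.
- exact: measurable_funM.
- move=> B mB; split; apply: key => // x /eqP; rewrite paddr_eq0// => /andP[/eqP ? /eqP ?] //.
Qed.

Section CountableSum.
Local Open Scope ereal_scope.
Context {R : realType}.

Lemma esumZl {I : choiceType} (Q : set I) (a : I -> \bar R) (c : R) :
  (0 <= c)%R -> (forall i, 0 <= a i) ->
  \esum_(i in Q) (c%:E * a i) = c%:E * \esum_(i in Q) a i.
Proof.
move=> c0 a0; rewrite /esum -ereal_supZl//; last first.
  by apply/set0P; exists (\sum_(i \in set0) a i); exists set0 => //; exact: fsets_set0.
congr ereal_sup; rewrite image_comp; apply: eq_imagel => F _ /=.
by rewrite ge0_mule_fsumr.
Qed.

Lemma measure_bigcup_esum {d} {T : measurableType d} (m : {measure set T -> \bar R})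
    {I : countType} (Q : set I) (F : I -> set T) :
  (forall i, measurable (F i)) -> trivIset setT F ->
  m (\bigcup_(i in Q) F i) = \esum_(i in Q) m (F i).
Proof.
move=> mF tF.
pose G n := if unpickle n is Some i then F i else set0.
have Gp i : G (pickle i) = F i by rewrite /G pickleK.
have -> : \bigcup_(i in Q) F i = \bigcup_(n in pickle @` Q) G n.
  by rewrite bigcup_image; apply: eq_bigcupr => i _; rewrite Gp.
rewrite measure_bigcup; last 2 first.
- by move=> _ [i _ <-]; rewrite Gp.
- by move=> _ _ [i _ <-] [j _ <-]; rewrite !Gp => /tF -> //.
rewrite nneseries_esum; last by move=> n _; exact: measure_ge0.
rewrite (_ : [set n | _] = pickle @` Q); last by apply/seteqP; split => n /=; rewrite inE.
rewrite esum_image; last by apply: in2W; exact: (pcan_inj (@pickleK I)).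
by apply: eq_esum => i _; rewrite Gp.
Qed.

End CountableSum.

(** * Histories and their joint law with the change points *)

Section History.
Context {K : nat} {T : Type} {Xs : Type} (X : 'I_K -> nat -> T -> Xs).

(* A history [h] lists, most recent first, the streams in the order in which
   their observations are revealed; [obs h] are the revealed pairs (stream, time). *)
Fixpoint obs (h : seq 'I_K) : seq ('I_K * nat) :=
  if h is k :: h' then (k, (count_mem k h').+1) :: obs h' else [::].

Definition rect (h : seq 'I_K) (B : 'I_K * nat -> set Xs) : set T :=
  [set w | forall kt, kt \in obs h -> B kt (X kt.1 kt.2 w)].

Lemma mem_obs h k s : ((k, s) \in obs h) = (0 < s <= count_mem k h)%N.
Proof.
elim: h => [|j h IH] /=; first by rewrite in_nil; case: s.
rewrite in_cons IH xpair_eqE [j == k]eq_sym; case: (eqVneq k j) => [->|_] //=.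
by rewrite add1n; case: s {IH} => //= s; rewrite ltnS [RHS]leq_eqVlt eqSS.
Qed.

Lemma uniq_obs h : uniq (obs h).
Proof. by elim: h => //= k h ->; rewrite mem_obs ltnn andbF. Qed.

Lemma rect_nil B : rect [::] B = setT.
Proof. by apply/seteqP; split => // w _ kt; rewrite in_nil. Qed.

Lemma rect_cons k h B : rect (k :: h) B =
  rect h B `&` (X k (count_mem k h).+1 @^-1` B (k, (count_mem k h).+1)).
Proof.
apply/seteqP; split=> [w rw|w [rw Bw] kt].
  split; first by move=> kt ktO; apply: rw; rewrite in_cons ktO orbT.
  by have := rw (k, (count_mem k h).+1); apply; rewrite mem_head.
by rewrite in_cons => /orP[/eqP->//|]; exact: rw.
Qed.

Lemma eq_rect h B B' : {in obs h, B =1 B'} -> rect h B = rect h B'.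
Proof.
by move=> e; apply/seteqP; split=> w rw kt ktO; have := rw _ ktO; rewrite e.
Qed.

End History.

Section Atoms.
Context {K : nat} {T : Type} (tau : 'I_K -> T -> option nat).

(** Indexed by finite functions, which form a countable type, so that masses are sums over atoms. *)
Definition atom (v : {ffun 'I_K -> nat}) : set T := [set w | forall k, tau k w = Some (v k)].

Definition atoms (Q : set {ffun 'I_K -> nat}) : set T := \bigcup_(v in Q) atom v.

Definition incr (k : 'I_K) (v : {ffun 'I_K -> nat}) : {ffun 'I_K -> nat} :=
  [ffun j => v j + (j == k)]%N.

Lemma trivIset_atom : trivIset setT atom.
Proof.
move=> v v' _ _ [w [vw v'w]]; apply/ffunP => k.
by have := vw k; rewrite (v'w k) => -[].
Qed.

Lemma atomsU Q Q' : atoms (Q `|` Q') = atoms Q `|` atoms Q'.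
Proof. exact: bigcup_setU. Qed.

Lemma atomsI0 Q Q' : Q `&` Q' = set0 -> atoms Q `&` atoms Q' = set0.
Proof.
move=> QQ; apply/seteqP; split => // w [[v Qv vw] [v' Qv' v'w]].
have e : v = v' by apply: trivIset_atom => //; exists w.
by have : (Q `&` Q') v by [split; rewrite // e]; rewrite QQ.
Qed.

End Atoms.

Section Law.
Local Open Scope ereal_scope.
Context {R : realType} {K : nat} {d : measure_display} {T : measurableType d} (P : probability T R)
  {dX : measure_display} {Xs : measurableType dX} (rho : {measure set Xs -> \bar R}) (p q : Xs -> R)
  (theta : R) (tau : 'I_K -> T -> option nat) (X : 'I_K -> nat -> T -> Xs).
Hypotheses (theta0 : (0 < theta)%R) (theta1 : (theta < 1)%R).
Hypotheses (p0 : forall x, (0 <= p x)%R) (q0 : forall x, (0 <= q x)%R).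
Hypothesis mtau : forall k m, measurable [set w | tau k w = m].
Hypothesis mX : forall k t, measurable_fun setT (X k t).
Hypothesis law : forall (v : {ffun 'I_K -> nat}) (F : seq ('I_K * nat)) (B : 'I_K * nat -> set Xs),
  uniq F -> (forall kt, kt \in F -> (0 < kt.2)%N) -> (forall kt, measurable (B kt)) ->
  P (atom tau v `&` [set w | forall kt, kt \in F -> B kt (X kt.1 kt.2 w)]) =
  (\prod_k (theta * (1 - theta) ^+ v k)%R)%:E *
  \prod_(kt <- F) \int[rho]_(x in B kt) (if (v kt.1 < kt.2)%N then q x else p x)%:E.

Implicit Types (v : {ffun 'I_K -> nat}) (Q : set {ffun 'I_K -> nat}) (k : 'I_K) (h : seq 'I_K).
Implicit Types (B : 'I_K * nat -> set Xs).

Lemma measurable_atom v : measurable (atom tau v).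
Proof.
rewrite (_ : atom tau v = \bigcap_(k in [set: 'I_K]) [set w | tau k w = Some (v k)]).
  by apply: fin_bigcap_measurable => //; exact: finite_finset.
by apply/seteqP; split => w h k; [move=> _; exact: h|exact: h].
Qed.

Lemma measurable_atoms Q : measurable (atoms tau Q).
Proof.
rewrite /atoms bigcup_mkcond; apply: countable_bigcupT_measurable => [|v].
  exact: countableP.
by case: ifP => _; [exact: measurable_atom|exact: measurable0].
Qed.

Lemma measurable_rect h B : (forall kt, measurable (B kt)) -> measurable (rect X h B).
Proof.
move=> mB; elim: h => [|k h IH]; first by rewrite rect_nil.
rewrite rect_cons; apply: measurableI => //.
by rewrite -[X in measurable X]setTI; exact: mX.
Qed.

Lemma mass_esum A Q : measurable A ->
  P (A `&` atoms tau Q) = \esum_(v in Q) P (A `&` atom tau v).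
Proof.
move=> mA; rewrite /atoms setI_bigcupr measure_bigcup_esum//.
  by move=> v; apply: measurableI => //; exact: measurable_atom.
by move=> v v' _ _ [w [[_ vw] [_ v'w]]]; exact: (@trivIset_atom _ _ tau v v' I I (ex_intro _ w (conj vw v'w))).
Qed.

Lemma mass_split A Q Q' : measurable A ->
  P (A `&` atoms tau Q) = P (A `&` atoms tau (Q `&` Q')) + P (A `&` atoms tau (Q `&` ~` Q')).
Proof.
move=> mA; rewrite -measureU.
- by rewrite -setIUr -atomsU -setIUr setUv setIT.
- by apply: measurableI => //; exact: measurable_atoms.
- by apply: measurableI => //; exact: measurable_atoms.
- by rewrite setIACA setIid atomsI0 ?setI0// setIACA setICr setI0.
Qed.

Lemma law_rect v h B : (forall kt, measurable (B kt)) ->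
  P (rect X h B `&` atom tau v) = (\prod_k (theta * (1 - theta) ^+ v k)%R)%:E *
  \prod_(kt <- obs h) \int[rho]_(x in B kt) (if (v kt.1 < kt.2)%N then q x else p x)%:E.
Proof.
move=> mB; rewrite setIC law ?uniq_obs// => -[k s].
by rewrite mem_obs => /andP[].
Qed.

(** Once [Q] decides whether stream [k] has changed before its next observation, the density of that
    observation is the same on all the atoms and its integral factors out. *)
Lemma mass_observe (b : bool) h k B Q :
  (forall kt, measurable (B kt)) -> (forall v, Q v -> (v k < (count_mem k h).+1)%N = b) ->
  \int[rho]_(x in B (k, (count_mem k h).+1)) (if b then q x else p x)%:E < +oo ->
  P (rect X (k :: h) B `&` atoms tau Q) =
  \int[rho]_(x in B (k, (count_mem k h).+1)) (if b then q x else p x)%:E *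
  P (rect X h B `&` atoms tau Q).
Proof.
move=> mB Qb Ioo; rewrite !mass_esum; try exact: measurable_rect.
set I := \int[rho]_(x in _) _.
have I0 : 0 <= I by apply: integral_ge0 => x _; rewrite lee_fin; case: ifP.
have IE : I = (fine I)%:E by rewrite fineK// ge0_fin_numE.
rewrite IE -esumZl ?fine_ge0//; apply: eq_esum => v Qv.
by rewrite -IE !law_rect//= big_cons /= Qb// muleCA.
Qed.

(** Lack of memory: delaying by one a change not yet visible in the history multiplies the geometric
    weight by [1 - theta] and alters no density of an observed variable. *)
Lemma mass_incr h k B v : (forall kt, measurable (B kt)) -> (count_mem k h <= v k)%N ->
  P (rect X h B `&` atom tau (incr k v)) = (1 - theta)%:E * P (rect X h B `&` atom tau v).
Proof.
move=> mB kv; rewrite !law_rect// muleA -EFinM; congr (_ * _).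
  congr EFin; rewrite (bigD1 k)//= [in RHS](bigD1 k)//= ffunE eqxx addn1 exprS.
  under eq_bigr => j jk do rewrite ffunE (negbTE jk) addn0.
  by rewrite mulrCA -!mulrA; congr (_ * _)%R; rewrite mulrCA.
rewrite big_seq [RHS]big_seq; apply: eq_bigr => -[j s]; rewrite mem_obs ffunE /=.
move=> /andP[s0 sh]; apply: eq_integral => x _; case: (eqVneq j k) => [jk|_]; last by rewrite addn0.
rewrite {j}jk in sh *; rewrite addn1 ltnNge (leq_trans (leq_trans sh kv))//.
by rewrite ltnNge (leq_trans sh kv).
Qed.

Lemma mass_shift h k B Q : (forall kt, measurable (B kt)) ->
  (forall v, Q (incr k v) <-> Q v) ->
  P (rect X h B `&` atoms tau (Q `&` [set v | (count_mem k h < v k)%N])) =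
  (1 - theta)%:E * P (rect X h B `&` atoms tau (Q `&` [set v | (count_mem k h <= v k)%N])).
Proof.
move=> mB Qk; rewrite !mass_esum; try exact: measurable_rect.
rewrite (@reindex_esum _ _ _ (Q `&` [set v | (count_mem k h <= v k)%N]) _ (incr k)); last first.
  split.
  - by move=> v [Qv /= kv]; split; [exact/Qk|rewrite /= ffunE eqxx addn1 ltnS].
  - by apply: in2W => v v' /ffunP e; apply/ffunP => j; have := e j; rewrite !ffunE => /addIn.
  - move=> v [Qv /= kv].
    have vE : incr k [ffun j => v j - (j == k)]%N = v.
      apply/ffunP => j; rewrite !ffunE; case: (eqVneq j k) => [->|_].
        by rewrite subnK// (leq_trans _ kv).
      by rewrite subn0 addn0.
    exists [ffun j => v j - (j == k)]%N => //; split; first by apply/Qk; rewrite vE.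
    by rewrite /= ffunE eqxx subn1 -ltnS prednK// (leq_trans _ kv).
rewrite -esumZl; last 2 first.
- by rewrite subr_ge0 ltW.
- by move=> v.
by apply: eq_esum => v [_ kv]; exact: mass_incr.
Qed.

(* Shifting one coordinate at a time shows that the total mass [c] of the atoms
   satisfies [theta ^ K = theta ^ K * c]. *)
Lemma atoms_full : P (atoms tau setT) = 1.
Proof.
pose c := fine (P (atoms tau setT)).
have Pfin A : measurable A -> P A = (fine (P A))%:E by move=> mA; rewrite fineK// fin_num_measure.
pose Q (l : seq 'I_K) := [set v : {ffun 'I_K -> nat} | forall k, k \in l -> v k = 0%N].
have QE l : uniq l -> P (atoms tau (Q l)) = (theta ^+ size l * c)%:E.
  elim: l => [_|k l IH /= /andP[kl /IH {}IH]].
    rewrite mul1r -Pfin; last exact: measurable_atoms.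
    by congr (P (atoms tau _)); apply/seteqP; split.
  have Qk v : Q l (incr k v) <-> Q l v.
    split=> Qv j jl; have := Qv j jl; rewrite ffunE; have [e|] := eqVneq j k.
    - by rewrite -e jl in kl.
    - by rewrite addn0.
    - by rewrite -e jl in kl.
    - by rewrite addn0.
  have mB : forall kt : 'I_K * nat, measurable ([set: Xs]) by [].
  have e : P (atoms tau (Q l `&` [set v | (0 < v k)%N])) = (1 - theta)%:E * P (atoms tau (Q l)).
    have := @mass_shift [::] k (fun=> setT) (Q l) mB Qk; rewrite rect_nil !setTI => ->.
    congr (_ * P (atoms tau _)); apply/seteqP; split=> v; first by case.
    by move=> Qv; split.
  rewrite IH in e.
  have := @mass_split setT (Q l) [set v | (0 < v k)%N] measurableT.
  rewrite !setTI IH e.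
  have -> : Q l `&` ~` [set v | (0 < v k)%N] = Q (k :: l).
    apply/seteqP; split=> [v [Qv /= /negP]|v Qv].
      by rewrite -eqn0Ngt => /eqP vk j; rewrite in_cons => /orP[/eqP->//|/Qv].
    split=> [j jl|/=]; first by apply: Qv; rewrite in_cons jl orbT.
    by rewrite Qv ?mem_head.
  rewrite (Pfin (atoms tau (Q (k :: l)))); last exact: measurable_atoms.
  rewrite -EFinM -EFinD => -[h]; congr EFin; rewrite exprS.
  by move: h; set z := fine _; set y := (_ * c)%R => h; rewrite -mulrA -/y; lra.
have := QE (enum 'I_K) (enum_uniq _).
have -> : Q (enum 'I_K) = [set [ffun=> 0%N]].
  apply/seteqP; split => [v Qv|v -> k _]; last by rewrite ffunE.
  by apply/ffunP => k; rewrite ffunE Qv ?mem_enum.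
rewrite /atoms bigcup_set1.
have := @law [ffun=> 0%N] [::] (fun=> setT); rewrite big_nil mule1.
rewrite (_ : [set w | _] = setT); last by apply/seteqP; split.
rewrite setIT => -> //.
under eq_bigr do rewrite ffunE expr0 mulr1.
rewrite prodr_const card_ord size_enum_ord => -[e].
rewrite (Pfin _ (measurable_atoms _)) -/c; congr EFin.
have tK : (theta ^+ K != 0)%R by rewrite expf_neq0// gt_eqF.
by apply: (mulfI tK); rewrite mulr1 -e.
Qed.

(** The law gives probabilities of finite change points only; infinite ones are null because the
    atoms have total mass 1. *)
Lemma mass_full A : measurable A -> P (A `&` atoms tau setT) = P A.
Proof.
move=> mA; have mS := measurable_atoms setT.
rewrite [RHS](measureDI P mA mS) [X in _ = X + _](_ : _ = 0) ?add0e//.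
apply: (@subset_measure0 _ _ _ P _ (~` atoms tau setT)).
- exact: measurableD.
- exact: measurableC.
- exact: subIsetr.
- by have := probability_setC P mS; rewrite atoms_full subee.
Qed.

End Law.

Lemma measurable_fun_restrictT {d} {T : measurableType d} {R : realType} (D : set T)
    (f : T -> \bar R) :
  measurable D -> measurable_fun setT f -> measurable_fun setT (f \_ D).
Proof. by move=> mD mf; apply: (measurable_restrictT _ mD).1; exact: measurable_funTS. Qed.

Lemma adde_inj_fin {R : realType} (a b c : \bar R) : a \is a fin_num ->
  (a + b = a + c)%E -> b = c.
Proof. by move=> af e; rewrite -(addeK b af) addeC [(b + a)%E]addeC e addeC [(a + c)%E]addeC addeK. Qed.

Lemma measurable_tau_lt {d} {T : measurableType d} (t : T -> option nat) n :
  (forall m, measurable [set w | t w = m]) -> measurable [set w | tau_lt (t w) n].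
Proof.
move=> mt; rewrite (_ : [set w | _] = \bigcup_(m in `I_n) [set w | t w = Some m]).
  by apply: fin_bigcup_measurable => //; exact: finite_II.
apply/seteqP; split=> w /=; last by move=> [m mn ->].
by rewrite /tau_lt; case E: (t w) => [m|] // mn; exists m.
Qed.

(** * Posteriors given the history of all streams *)

Section Filtering.
Context {R : realType} {K : nat} {d : measure_display} {T : measurableType d} (P : probability T R)
  {dX : measure_display} {Xs : measurableType dX} (rho : {finite_measure set Xs -> \bar R})
  (p q : Xs -> R) (theta : R) (tau : 'I_K -> T -> option nat) (X : 'I_K -> nat -> T -> Xs).
Hypotheses (theta0 : 0 < theta) (theta1 : theta < 1).
Hypotheses (p0 : forall x, 0 <= p x) (q0 : forall x, 0 <= q x).
Hypotheses (mp : measurable_fun setT p) (mq : measurable_fun setT q).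
Hypotheses (p1 : (\int[rho]_x (p x)%:E = 1)%E) (q1 : (\int[rho]_x (q x)%:E = 1)%E).
Hypothesis mtau : forall k m, measurable [set w | tau k w = m].
Hypothesis mX : forall k t, measurable_fun setT (X k t).
Hypothesis law : forall (v : {ffun 'I_K -> nat}) (F : seq ('I_K * nat)) (B : 'I_K * nat -> set Xs),
  uniq F -> (forall kt, kt \in F -> (0 < kt.2)%N) -> (forall kt, measurable (B kt)) ->
  P (atom tau v `&` [set w | forall kt, kt \in F -> B kt (X kt.1 kt.2 w)]) =
  ((\prod_k (theta * (1 - theta) ^+ v k)%R)%:E *
  \prod_(kt <- F) \int[rho]_(x in B kt) (if (v kt.1 < kt.2)%N then q x else p x)%:E)%E.

Implicit Types (k : 'I_K) (h : seq 'I_K) (E : {set 'I_K}) (B : 'I_K * nat -> set Xs).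

(** The recursion starts from the probability 0 of [tau_k < 0]; at [t] it gives the posterior
    probability of [tau_k < t]. *)
Fixpoint post_at k t (w : T) : R :=
  if t is t'.+1 then posterior p q (prior theta (post_at k t' w)) (X k t'.+1 w) else 0.

Definition post_hist h w : 'I_K -> R := fun k => post_at k (count_mem k h) w.

Lemma post_at_itv k t w : 0 <= post_at k t w <= 1.
Proof. by case: t => [|t] /=; [rewrite lexx ler01|rewrite posterior_itv ?prior_itv]. Qed.

Lemma post_hist_cons k h w : post_hist (k :: h) w = update (post_hist h w) k
  (posterior p q (prior theta (post_hist h w k)) (X k (count_mem k h).+1 w)).
Proof.
apply/funext => j; rewrite /post_hist /update /= [k == j]eq_sym.
by case: (eqVneq j k) => [->|_].
Qed.

Definition rects h : set (set T) :=
  [set A | exists B, (forall kt, measurable (B kt)) /\ A = rect X h B].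

Lemma rects_setI h : setI_closed (rects h).
Proof.
move=> _ _ [B [mB ->]] [B' [mB' ->]]; exists (fun kt => B kt `&` B' kt); split.
  by move=> kt; exact: measurableI.
apply/seteqP; split=> [w [r r'] kt ktO|w r]; first by split; [exact: r|exact: r'].
by split=> kt /r [].
Qed.

Lemma rects_setT h : rects h setT.
Proof. by exists (fun=> setT); split => //; apply/seteqP; split. Qed.

Lemma rects_measurable h : rects h `<=` measurable.
Proof. by move=> _ [B [mB ->]]; exact: measurable_rect. Qed.

Lemma hist_measurable h A : <<s rects h >> A -> measurable A.
Proof.
apply: (@smallest_sub _ _ _ (@measurable _ T)); last exact: rects_measurable.
exact: sigma_algebra_measurable.
Qed.

Lemma hist_cons k h A : <<s rects h >> A -> <<s rects (k :: h) >> A.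
Proof.
apply: sub_sigma_algebra2 => _ [B [mB ->]].
(* The new observation must be left unconstrained, whatever [B] is at its index. *)
exists (fun kt => if kt \in obs h then B kt else setT); split.
  by move=> kt; case: ifP.
rewrite rect_cons mem_obs ltnn andbF preimage_setT setIT.
by apply: eq_rect => kt ->.
Qed.

Local Notation Hist h := (g_sigma_algebraType (rects h)).

Lemma hist_obs k s h : (0 < s <= count_mem k h)%N ->
  measurable_fun (setT : set (Hist h)) (X k s).
Proof.
move=> sh _ Y mY; rewrite setTI; apply: sub_sigma_algebra.
exists (fun kt => if kt == (k, s) then Y else setT); split; first by move=> kt; case: ifP.
apply/seteqP; split=> [w Yw kt ktO|w]; first by case: eqP => // ->.
by move=> /(_ (k, s)); rewrite mem_obs sh eqxx; apply.
Qed.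

Lemma hist_post_at k s h : (s <= count_mem k h)%N ->
  measurable_fun (setT : set (Hist h)) (post_at k s).
Proof.
elim: s => [|s IH] sh; first exact: measurable_cst.
apply: measurable_posterior => //.
- by move=> w; exact: prior_itv.
- by apply: measurable_prior; apply: IH; exact: ltnW.
- exact: hist_obs.
Qed.

Lemma hist_post h k : measurable_fun (setT : set (Hist h)) (fun w => post_hist h w k).
Proof. exact: hist_post_at. Qed.

Lemma hist_id h : measurable_fun setT (idfun : T -> Hist h).
Proof. by move=> _ Y mY; rewrite setTI; exact: hist_measurable mY. Qed.

Lemma hist_measurable_fun {d'} {U : measurableType d'} h (f : T -> U) :
  measurable_fun (setT : set (Hist h)) f -> measurable_fun setT f.
Proof.
move=> mf _ Y mY; rewrite setTI; apply: (@hist_measurable h).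
by have := mf measurableT Y mY; rewrite setTI.
Qed.

(* The posteriors of distinct streams are conditionally independent; carrying all
   products [survival E] through the induction encodes this without conditional
   expectations. *)
Definition no_change E h : set {ffun 'I_K -> nat} :=
  [set v | forall k, k \in E -> (count_mem k h <= v k)%N].

Definition survival E h w : R := \prod_(k in E) (1 - post_hist h w k).

Definition filtered h := forall C E, <<s rects h >> C ->
  P (C `&` atoms tau (no_change E h)) = (\int[P]_(w in C) (survival E h w)%:E)%E.

Lemma survival_ge0 E h w : 0 <= survival E h w.
Proof.
by apply: prodr_ge0 => k _; rewrite subr_ge0; have /andP[] := post_at_itv k (count_mem k h) w.
Qed.

Lemma hist_survival E h : measurable_fun (setT : set (Hist h)) (survival E h).
Proof.
rewrite /survival (_ : (fun w => _) = (fun w => \prod_(k <- enum E) (1 - post_hist h w k))).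
  by apply: measurable_prod => k _; apply: measurable_funB => //; exact: hist_post.
by apply/funext => w; rewrite big_enum.
Qed.

Let U h k w := prior theta (post_hist h w k).

Let U01 h k w : 0 <= U h k w <= 1. Proof. exact: prior_itv. Qed.

Let mU h k : measurable_fun (setT : set (Hist h)) (U h k).
Proof. by apply: measurable_prior; exact: hist_post. Qed.

Let mfst h (f : T -> R) : measurable_fun (setT : set (Hist h)) f ->
  measurable_fun (setT : set (Hist h * Xs)%type) (fun z => f z.1).
Proof.
move=> mf.
exact: (@measurableT_comp _ _ _ (Hist h * Xs)%type (Hist h) R f setT fst mf measurable_fst).
Qed.

Let mU1 h k : measurable_fun (setT : set (Hist h * Xs)%type) (fun z => U h k z.1).
Proof. exact: (@mfst h (U h k) (@mU h k)). Qed.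

Let hist_rect h B : (forall kt, measurable (B kt)) -> <<s rects h >> (rect X h B).
Proof. by move=> mB; apply: sub_sigma_algebra; exists B. Qed.

Let mf_int h (f : T -> R) (D : set T) : measurable_fun (setT : set (Hist h)) f ->
  measurable_fun D (EFin \o f).
Proof.
by move=> mf; apply: measurable_funTS; apply/measurable_EFinP; exact: hist_measurable_fun mf.
Qed.

(** [mass_shift] replaces survival of [k] beyond the next observation by [1 - theta] times survival
    so far, which [filtered] evaluates on [k |: E]. The factors combine since
    [(1 - v) * (1 - theta)] is 1 minus the prior. *)
Lemma predict_no_change h k E B : filtered h -> k \notin E -> (forall kt, measurable (B kt)) ->
  P (rect X h B `&` atoms tau (no_change E h `&` [set v | (count_mem k h < v k)%N])) =
  (\int[P]_(w in rect X h B) (survival E h w * (1 - U h k w))%:E)%E.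
Proof.
move=> fh kE mB.
have Qk v : no_change E h (incr k v) <-> no_change E h v.
  split=> Qv j jE; have := Qv j jE; rewrite ffunE; have [e|_] := eqVneq j k; rewrite ?addn0//.
  - by rewrite -e jE in kE.
  - by rewrite -e jE in kE.
rewrite (mass_shift theta1 mtau mX law h mB Qk).
have -> : no_change E h `&` [set v | (count_mem k h <= v k)%N] = no_change (k |: E) h.
  apply/seteqP; split=> v; first by case=> Qv kv j; rewrite in_setU1 => /orP[/eqP->|/Qv].
  move=> Qv; split=> [j jE|]; apply: Qv; first by rewrite finset.in_setU1 jE orbT.
  by rewrite finset.setU11.
rewrite fh; last exact: hist_rect.
have mC := measurable_rect mX h mB.
rewrite -ge0_integralZl_EFin//; last 3 first.
- by move=> w _; rewrite lee_fin survival_ge0.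
- by apply: mf_int; exact: hist_survival.
- by rewrite subr_ge0 ltW.
apply: eq_integral => w _; rewrite -EFinM; congr EFin.
rewrite /survival big_setU1//= /U prior_id; first by ring.
- exact: post_at_itv.
- by rewrite !ltW.
Qed.

Lemma predict_change h k E B : filtered h -> k \notin E -> (forall kt, measurable (B kt)) ->
  P (rect X h B `&` atoms tau (no_change E h `&` ~` [set v | (count_mem k h < v k)%N])) =
  (\int[P]_(w in rect X h B) (survival E h w * U h k w)%:E)%E.
Proof.
move=> fh kE mB; have mC := measurable_rect mX h mB.
have := mass_split P mtau (no_change E h) [set v | (count_mem k h < v k)%N] mC.
rewrite fh; last exact: hist_rect.
rewrite predict_no_change//.
have -> : (\int[P]_(w in rect X h B) (survival E h w)%:E =
    \int[P]_(w in rect X h B) (survival E h w * (1 - U h k w))%:E +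
    \int[P]_(w in rect X h B) (survival E h w * U h k w)%:E)%E.
  rewrite -ge0_integralD//.
  - by apply: eq_integral => w _; rewrite -EFinD -mulrDr subrK mulr1.
  - by move=> w _; rewrite lee_fin mulr_ge0 ?survival_ge0// subr_ge0; have /andP[] := U01 h k w.
  - apply: (@mf_int h (fun w => survival E h w * (1 - U h k w))).
    by apply: measurable_funM; [exact: hist_survival|exact: measurable_funB].
  - by move=> w _; rewrite lee_fin mulr_ge0 ?survival_ge0//; have /andP[] := U01 h k w.
  - apply: (@mf_int h (fun w => survival E h w * U h k w)).
    by apply: measurable_funM; [exact: hist_survival|].
rewrite -predict_no_change// => e.
have afin : P (rect X h B `&` atoms tau (no_change E h `&` [set v | (count_mem k h < v k)%N]))
    \is a fin_num.
  by rewrite fin_num_measure//; apply: measurableI => //; exact: measurable_atoms.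
by rewrite -[LHS](addeK _ afin) [X in (X - _)%E]addeC -e [X in (X - _)%E]addeC addeK.
Qed.

Lemma integral_mixture_on u Y : measurable Y -> 0 <= u <= 1 ->
  (\int[rho]_(x in Y) (mixture p q u x)%:E =
   (u * fine (\int[rho]_(x in Y) (q x)%:E) + (1 - u) * fine (\int[rho]_(x in Y) (p x)%:E))%:E)%E.
Proof.
move=> mY /andP[u0 u1].
have fin (f : Xs -> R) : (forall x, 0 <= f x) -> measurable_fun setT f ->
    (\int[rho]_x (f x)%:E = 1)%E -> (\int[rho]_(x in Y) (f x)%:E)%E \is a fin_num.
  move=> f0 mf f1; rewrite ge0_fin_numE; last by apply: integral_ge0 => x _; rewrite lee_fin.
  apply: (@le_lt_trans _ _ 1%E); last exact: ltry.
  rewrite -f1; apply: ge0_subset_integral => //; first exact/measurable_EFinP.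
  by move=> x _; rewrite lee_fin.
have mZ (c : R) (f : Xs -> R) : measurable_fun setT f ->
    measurable_fun Y (fun x : Xs => (c%:E * (f x)%:E)%E).
  by move=> mf; apply: measurable_funTS; apply/measurable_EFinP; exact: measurable_funM.
rewrite EFinD !EFinM !fineK ?fin// -!ge0_integralZl_EFin ?subr_ge0//; first last.
- by apply: measurable_funTS; exact/measurable_EFinP.
- by move=> x _; rewrite lee_fin.
- by apply: measurable_funTS; exact/measurable_EFinP.
- by move=> x _; rewrite lee_fin.
rewrite -ge0_integralD//; last 4 first.
- by move=> x _; rewrite mule_ge0 ?lee_fin.
- exact: mZ.
- by move=> x _; rewrite mule_ge0 ?lee_fin ?subr_ge0.
- exact: mZ.
Qed.

Let on D (f : Xs -> R) : R := fine (\int[rho]_(x in D) (f x)%:E)%E.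

Let int_fin (f : Xs -> R) D : measurable D -> (forall x, 0 <= f x) -> measurable_fun setT f ->
  (\int[rho]_x (f x)%:E = 1)%E -> (\int[rho]_(x in D) (f x)%:E < +oo)%E.
Proof.
move=> mD f0 mf f1; apply: (@le_lt_trans _ _ 1%E); last exact: ltry.
rewrite -f1; apply: ge0_subset_integral => //; first exact/measurable_EFinP.
by move=> x _; rewrite lee_fin.
Qed.

Let onE (f : Xs -> R) D : measurable D -> (forall x, 0 <= f x) -> measurable_fun setT f ->
  (\int[rho]_x (f x)%:E = 1)%E -> (\int[rho]_(x in D) (f x)%:E = (on D f)%:E)%E.
Proof.
move=> mD f0 mf f1; rewrite fineK// ge0_fin_numE ?int_fin//.
by apply: integral_ge0 => x _; rewrite lee_fin.
Qed.

Let on_ge0 D (f : Xs -> R) : (forall x, 0 <= f x) -> 0 <= on D f.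
Proof. by move=> f0; apply: fine_ge0; apply: integral_ge0 => x _; rewrite lee_fin. Qed.

Section Next.
Variables (h : seq 'I_K) (k : 'I_K).
Hypothesis fh : filtered h.

Let Y := X k (count_mem k h).+1.

Let mY : measurable_fun setT Y. Proof. exact: mX. Qed.

Let mYD D : measurable D -> measurable (Y @^-1` D).
Proof. by move=> mD; rewrite -[X in measurable X]setTI; exact: mY. Qed.

Let ge0Zl C (f : T -> R) (c : R) : measurable C -> 0 <= c -> (forall w, 0 <= f w) ->
  measurable_fun (setT : set (Hist h)) f ->
  (c%:E * \int[P]_(w in C) (f w)%:E = \int[P]_(w in C) (f w * c)%:E)%E.
Proof.
move=> mC c0 f0 mf; rewrite -ge0_integralZl_EFin//.
- by apply: eq_integral => w _; rewrite -EFinM mulrC.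
- by move=> w _; rewrite lee_fin.
- exact: mf_int mf.
Qed.

Let sU0 E w : 0 <= survival E h w * (1 - U h k w).
Proof.
by rewrite mulr_ge0 ?survival_ge0// subr_ge0; have /andP[] := U01 h k w.
Qed.

Let sU1 E w : 0 <= survival E h w * U h k w.
Proof. by rewrite mulr_ge0 ?survival_ge0//; have /andP[] := U01 h k w. Qed.

Let msU0 E : measurable_fun (setT : set (Hist h)) (fun w => survival E h w * (1 - U h k w)).
Proof. by apply: measurable_funM; [exact: hist_survival|exact: measurable_funB]. Qed.

Let msU1 E : measurable_fun (setT : set (Hist h)) (fun w => survival E h w * U h k w).
Proof. by apply: measurable_funM; [exact: hist_survival|]. Qed.

Let mass_next_no_change E B : k \notin E -> (forall kt, measurable (B kt)) ->
  P (rect X (k :: h) B `&` atoms tau (no_change E h `&` [set v | (count_mem k h < v k)%N])) =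
  (\int[P]_(w in rect X h B)
    (survival E h w * (1 - U h k w) * on (B (k, (count_mem k h).+1)) p)%:E)%E.
Proof.
move=> kE mB; rewrite (mass_observe p0 q0 mtau mX law (b := false))//; last 2 first.
- by move=> v [_ /= kv]; rewrite ltnS leqNgt kv.
- exact: int_fin.
rewrite predict_no_change// onE// ge0Zl ?on_ge0//.
exact: measurable_rect.
Qed.

Let mass_next_change E B : k \notin E -> (forall kt, measurable (B kt)) ->
  P (rect X (k :: h) B `&` atoms tau (no_change E h `&` ~` [set v | (count_mem k h < v k)%N])) =
  (\int[P]_(w in rect X h B)
    (survival E h w * U h k w * on (B (k, (count_mem k h).+1)) q)%:E)%E.
Proof.
move=> kE mB; rewrite (mass_observe p0 q0 mtau mX law (b := true))//; last 2 first.
- by move=> v [_ /= /negP]; rewrite -leqNgt ltnS.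
- exact: int_fin.
rewrite predict_change// onE// ge0Zl ?on_ge0//.
exact: measurable_rect.
Qed.

Let mass_next E B : k \notin E -> (forall kt, measurable (B kt)) ->
  P (rect X (k :: h) B `&` atoms tau (no_change E h)) =
  (\int[P]_(w in rect X h B) (survival E h w *
    (U h k w * on (B (k, (count_mem k h).+1)) q + (1 - U h k w) * on (B (k, (count_mem k h).+1)) p))%:E)%E.
Proof.
move=> kE mB; rewrite (mass_split P mtau _ [set v | (count_mem k h < v k)%N]); last exact: measurable_rect.
rewrite mass_next_no_change// mass_next_change// -ge0_integralD//.
- by apply: eq_integral => w _; rewrite -EFinD; congr EFin; ring.
- exact: measurable_rect.
- by move=> w _; rewrite lee_fin mulr_ge0 ?on_ge0.
- by apply: (@mf_int h (fun w => _ * _ * _)); exact: measurable_funM.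
- by move=> w _; rewrite lee_fin mulr_ge0 ?on_ge0.
- by apply: (@mf_int h (fun w => _ * _ * _)); exact: measurable_funM.
Qed.

(** Given the history, the next observation of [k] has the mixture as density. Both sides are finite
    measures in [C], compared on rectangles. *)
Lemma predict_observation C D : <<s rects h >> C -> measurable D ->
  P (C `&` Y @^-1` D) = (\int[P]_(w in C) \int[rho]_(x in D) (mixture p q (U h k w) x)%:E)%E.
Proof.
move=> hC mD.
pose f w := U h k w * on D q + (1 - U h k w) * on D p.
have f0 w : 0 <= f w.
  by have /andP[u0 u1] := U01 h k w; rewrite addr_ge0 ?mulr_ge0 ?subr_ge0 ?on_ge0.
have mfh : measurable_fun (setT : set (Hist h)) f.
  apply: measurable_funD; apply: measurable_funM => //.
  exact: measurable_funB.
have mf : measurable_fun setT f := hist_measurable_fun mfh.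
transitivity (density P mf f0 C); last first.
  by apply: eq_integral => w _; rewrite integral_mixture_on.
apply: (pi_measure_unique (m1 := mrestr P (mYD mD)) (m2 := density P mf f0)
  (@rects_measurable h) (@rects_setI h) (rects_setT h)) hC.
  by apply: (le_lt_trans (probability_le1 P (measurableI _ _ measurableT (mYD mD)))); rewrite ltry.
move=> _ [B [mB ->]].
(* The changed index is not yet in [obs h], so the rectangle of [h] is unaffected while that of
   [k :: h] acquires the constraint [D]. *)
pose B' kt := if kt == (k, (count_mem k h).+1) then D else B kt.
have mB' kt : measurable (B' kt) by rewrite /B'; case: ifP.
have e : rect X h B = rect X h B'.
  apply: eq_rect => kt ktO; rewrite /B'; case: eqP => // ktE.
  by rewrite ktE mem_obs ltnn andbF in ktO.
have BD : B' (k, (count_mem k h).+1) = D by rewrite /B' eqxx.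
transitivity (P (rect X (k :: h) B')); first by rewrite rect_cons -e BD.
rewrite -(mass_full theta0 theta1 mtau mX law) //; last exact: measurable_rect.
(* The total mass is the survival of the empty set of streams, so [mass_next] applies. *)
have -> : [set: {ffun 'I_K -> nat}] = no_change finset.set0 h.
  by apply/seteqP; split => // v _ j; rewrite finset.in_set0.
rewrite mass_next// ?finset.in_set0// BD -e.
by apply: eq_integral => w _; rewrite /survival big_set0 mul1r.
Qed.

(** The pair of history and next observation has density [f] with respect to the product of the law
    of the history and [rho]. The two measures agree on products [C * D] by
    [predict_observation]. *)
Lemma predict_fun (g : T * Xs -> \bar R) :
  measurable_fun (setT : set (Hist h * Xs)%type) g -> (forall z, (0 <= g z)%E) ->
  (\int[P]_w g (w, Y w) =
   \int[P]_w \int[rho]_x (g (w, x) * (mixture p q (U h k w) x)%:E))%E.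
Proof.
move=> mg g0.
(* The history is [T] itself with a coarser sigma-algebra; the distribution of the identity is [P]
   restricted to it. *)
pose idf : {mfun T >-> Hist h} :=
  HB.pack (idfun : T -> Hist h) (isMeasurableFun.Build _ _ _ _ _ (@hist_id h)).
pose PH := distribution P idf.
pose phi (w : T) : (Hist h * Xs)%type := (w, Y w).
have mphi : measurable_fun setT phi by exact: measurable_fun_pair (@hist_id h) mY.
pose phif : {mfun T >-> (Hist h * Xs)%type} :=
  HB.pack phi (isMeasurableFun.Build _ _ _ _ _ mphi).
pose f (z : (Hist h * Xs)%type) := mixture p q (U h k z.1) z.2.
have f0 z : 0 <= f z by exact: mixture_ge0.
have mf : measurable_fun setT f.
  by apply: measurable_mixture => //; exact: mU1.
have gf0 (z : (Hist h * Xs)%type) : (0 <= g z * (f z)%:E)%E by rewrite mule_ge0 ?lee_fin.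
have mgf : measurable_fun (setT : set (Hist h * Xs)%type) (fun z => g z * (f z)%:E)%E.
  by apply: emeasurable_funM => //; exact/measurable_EFinP.
transitivity (\int[distribution P phif]_z g z)%E.
  by rewrite ge0_integral_distribution.
transitivity (\int[density (PH \x rho) mf f0]_z g z)%E; last first.
  rewrite integral_density// fubini_tonelli1//.
  rewrite ge0_integral_distribution//.
  - exact: (measurable_fun_fubini_tonelli_F (m2 := rho) _ mgf gf0).
  - by move=> w; apply: integral_ge0 => x _; exact: gf0.
apply: eq_measure_integral => A mA _.
apply: (measure_unique [set A `*` B | A in measurable & B in measurable] (fun=> setT)
  _ _ _ _ (distribution P phif) (density (PH \x rho)%E mf f0)) => //.
- by rewrite measurable_prod_measurableType.
- move=> _ _ [A1 mA1 [B1 mB1 <-]] [A2 mA2 [B2 mB2 <-]]; exists (A1 `&` A2); first exact: measurableI.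
  by exists (B1 `&` B2); [exact: measurableI|rewrite setXI].
- by move=> _; exists setT => //; exists setT => //; rewrite setXTT.
- by rewrite bigcup_const.
- move=> _ [C mC [D mD <-]].
  transitivity (P (C `&` Y @^-1` D)); first by congr (P _); apply/seteqP; split.
  rewrite predict_observation//; transitivity (\int[(PH \x rho)%E]_(z in C `*` D) (f z)%:E)%E => //.
  have mCD : measurable (C `*` D : set (Hist h * Xs)%type) by exact: measurableX.
  have mfE : measurable_fun (setT : set (Hist h * Xs)%type) ((EFin \o f) \_ (C `*` D)).
    by apply: measurable_fun_restrictT mCD _; exact/measurable_EFinP.
  have fE0 (z : (Hist h * Xs)%type) : (0 <= ((EFin \o f) \_ (C `*` D)) z)%E.
    by apply: erestrict_ge0 => {}z _; rewrite lee_fin.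
  rewrite [RHS]integral_mkcond fubini_tonelli1// ge0_integral_distribution//; last 2 first.
  - exact: (measurable_fun_fubini_tonelli_F (m2 := rho) _ mfE fE0).
  - by move=> w; apply: integral_ge0 => x _; exact: fE0.
  rewrite integral_mkcond; apply: eq_integral => w _; rewrite patchE /= /fubini_F.
  case: ifPn => wC.
    rewrite [LHS]integral_mkcond; apply: eq_integral => x _; rewrite !patchE in_setX wC/=.
    by case: ifP.
  by rewrite integral0_eq// => x _; rewrite patchE in_setX (negbTE wC).
- by move=> _; rewrite (le_lt_trans (probability_le1 (distribution P phif) measurableT)) ?ltry.
Qed.

(** Used for the induction step of the filter, with [s] constant 1 and with [s] the updated survival
    probability of [k]. *)
Lemma predict_integral (C : set T) (D : set Xs) (phi : T -> R) (s : R -> Xs -> R) (r : R -> R) :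
  <<s rects h >> C -> measurable D ->
  measurable_fun (setT : set (Hist h)) phi -> (forall w, 0 <= phi w) ->
  measurable_fun (setT : set (Hist h * Xs)%type) (fun z => s (U h k z.1) z.2) ->
  (forall u x, 0 <= u <= 1 -> 0 <= s u x) ->
  (forall u, 0 <= u <= 1 ->
    (\int[rho]_(x in D) (s u x * mixture p q u x)%:E = (r u)%:E)%E) ->
  (\int[P]_(w in C `&` Y @^-1` D) (phi w * s (U h k w) (Y w))%:E =
   \int[P]_(w in C) (phi w * r (U h k w))%:E)%E.
Proof.
move=> hC mD mphi phi0 ms s0 rE.
pose g (z : T * Xs) := ((fun z : T * Xs => (phi z.1 * s (U h k z.1) z.2)%:E) \_ (C `*` D)) z.
have g0 z : (0 <= g z)%E.
  by apply: erestrict_ge0 => {}z _; rewrite lee_fin mulr_ge0// s0.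
have mg : measurable_fun (setT : set (Hist h * Xs)%type) g.
  have mCD : measurable (C `*` D : set (Hist h * Xs)%type) by exact: measurableX.
  apply: measurable_fun_restrictT mCD _; apply/measurable_EFinP.
  by apply: measurable_funM => //; exact: (@mfst h phi).
transitivity (\int[P]_w g (w, Y w))%E.
  rewrite integral_mkcond; apply: eq_integral => w _; by rewrite /g !patchE in_setX in_setI.
rewrite predict_fun//.
rewrite [RHS]integral_mkcond; apply: eq_integral => w _; rewrite patchE; case: ifPn => wC; last first.
  by rewrite integral0_eq// => x _; rewrite /g patchE in_setX (negbTE wC) mul0e.
transitivity ((phi w)%:E * \int[rho]_(x in D) (s (U h k w) x * mixture p q (U h k w) x)%:E)%E; last first.
  by rewrite rE.
have mw : measurable_fun D (fun x => (s (U h k w) x * mixture p q (U h k w) x)%:E).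
  apply: measurable_funTS; apply/measurable_EFinP; apply: measurable_funM.
    exact: (measurableT_comp ms (pair1_measurable (w : Hist h))).
  exact: measurable_mixture.
rewrite -ge0_integralZl_EFin//.
- rewrite [RHS]integral_mkcond; apply: eq_integral => x _.
  rewrite /g !patchE in_setX wC /=; case: ifP => _; last by rewrite mul0e.
  by rewrite -!EFinM mulrA.
- by move=> x _; rewrite lee_fin mulr_ge0 ?s0 ?mixture_ge0.
Qed.

Let count_other j : j != k -> count_mem j (k :: h) = count_mem j h.
Proof. by rewrite eq_sym /= => /negbTE ->. Qed.

Let count_self : count_mem k (k :: h) = (count_mem k h).+1.
Proof. by rewrite /= eqxx. Qed.

Let survival_other E w : k \notin E -> survival E (k :: h) w = survival E h w.
Proof.
move=> kE; apply: eq_bigr => j jE; rewrite /post_hist count_other//.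
by apply: contraNneq kE => <-.
Qed.

Let no_change_other E : k \notin E -> no_change E (k :: h) = no_change E h.
Proof.
move=> kE; apply/seteqP; split=> v Qv j jE; have := Qv j jE; rewrite count_other//;
by apply: contraNneq kE => <-.
Qed.

(** If [k] is not in [E], the observation contributes its predictive density alone. If it is, the
    factor of [k] is split off, and Bayes' formula in the form [posteriorC] turns updated survival
    times mixture into [(1 - u) * p]. *)
Lemma filtered_cons : filtered (k :: h).
Proof.
move=> C E hC.
have mf := hist_measurable_fun (@hist_survival E (k :: h)).
have f0 w := survival_ge0 E (k :: h) w.
have mA := measurable_atoms mtau (no_change E (k :: h)).
apply: (pi_measure_unique (m1 := mrestr P mA) (m2 := density P mf f0)
  (@rects_measurable _) (@rects_setI _) (rects_setT _)) hC.
  by apply: (le_lt_trans (probability_le1 P (measurableI _ _ measurableT mA))); rewrite ltry.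
move=> _ [B [mB ->]].
set D := B (k, (count_mem k h).+1).
have mD : measurable D by exact: mB.
transitivity (P (rect X (k :: h) B `&` atoms tau (no_change E (k :: h)))) => //.
transitivity (\int[P]_(w in rect X h B `&` Y @^-1` D) (survival E (k :: h) w)%:E)%E; last first.
  by rewrite /D /Y -rect_cons.
have [kE|kE] := boolP (k \in E); last first.
  rewrite no_change_other// mass_next//.
  under [in RHS]eq_integral do rewrite survival_other// -[survival E h _]mulr1.
  rewrite (@predict_integral _ _ (survival E h) (fun _ _ => 1)
    (fun u => u * on D q + (1 - u) * on D p))//.
  - exact: hist_rect.
  - exact: hist_survival.
  - by move=> w; exact: survival_ge0.
  - move=> u u01; under eq_integral do rewrite mul1r.
    exact: integral_mixture_on.
set E' := E :\ k; have kE' : k \notin E' by rewrite !inE eqxx.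
have -> : no_change E (k :: h) = no_change E' h `&` [set v | (count_mem k h < v k)%N].
  apply/seteqP; split=> v.
    move=> Qv; split; last by have := Qv k kE; rewrite count_self.
    by move=> j; rewrite !inE => /andP[jk jE]; have := Qv j jE; rewrite count_other.
  move=> [Qv /= kv] j jE; have [->|jk] := eqVneq j k; first by rewrite count_self.
  by rewrite count_other//; apply: Qv; rewrite !inE jk.
rewrite mass_next_no_change// -/D.
have sE w : survival E (k :: h) w = survival E' h w * (1 - posterior p q (U h k w) (Y w)).
  rewrite /survival (big_setD1 k)//= mulrC -/(survival E' (k :: h) w) survival_other//.
  by rewrite post_hist_cons update_same.
under [in RHS]eq_integral do rewrite sE.
rewrite (@predict_integral _ _ (survival E' h) (fun u x => 1 - posterior p q u x)
  (fun u => (1 - u) * on D p))//.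
- by apply: eq_integral => w _; rewrite mulrA.
- exact: hist_rect.
- exact: hist_survival.
- by move=> w; exact: survival_ge0.
- by apply: measurable_funB => //; apply: measurable_posterior => //; exact: mU1.
- by move=> u x u01; rewrite subr_ge0; have /andP[] := posterior_itv p0 q0 x u01.
- move=> u u01; have /andP[u0 u1] := u01.
  under eq_integral do rewrite posteriorC// EFinM.
  rewrite [RHS]EFinM -onE// ge0_integralZl_EFin ?subr_ge0//.
  + by move=> x _; rewrite lee_fin.
  + by apply: measurable_funTS; exact/measurable_EFinP.
Qed.

End Next.

Lemma filtered_nil : filtered [::].
Proof.
move=> C E hC.
have -> : no_change E [::] = setT by apply/seteqP; split.
rewrite (mass_full theta0 theta1 mtau mX law); last exact: hist_measurable hC.
have -> : (\int[P]_(w in C) (survival E [::] w)%:E = \int[P]_(w in C) (cst 1 w))%E.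
  by apply: eq_integral => w _; rewrite /survival big1// => k _; rewrite subr0.
by rewrite integral_cst ?mul1e//; exact: hist_measurable hC.
Qed.

Lemma filteredP h : filtered h.
Proof. by elim: h => [|k h IH]; [exact: filtered_nil|exact: filtered_cons]. Qed.

(** Complement of the survival of the single stream [k], infinite change points being null. *)
Lemma posterior_change h k C : <<s rects h >> C ->
  P (C `&` [set w | tau_lt (tau k w) (count_mem k h)]) =
  (\int[P]_(w in C) (post_hist h w k)%:E)%E.
Proof.
move=> hC; have mC := hist_measurable hC; set t := count_mem k h.
have mk := measurable_tau_lt t (mtau k).
rewrite -(mass_full theta0 theta1 mtau mX law); last exact: measurableI.
have -> : C `&` [set w | tau_lt (tau k w) t] `&` atoms tau setT =
    C `&` atoms tau (setT `&` ~` no_change [set k]%SET h).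
  rewrite -setIA; congr (_ `&` _); apply/seteqP; split=> w.
    move=> [wt [v _ vw]]; exists v => //; split => // /(_ k); rewrite finset.set11 => /(_ isT) tv.
    by move: wt; rewrite /= vw /= ltnNge tv.
  move=> [v [_ nv] vw]; split; last by exists v.
  rewrite /= vw /= ltnNge; apply/negP => tv; apply: nv => j; rewrite finset.in_set1 => /eqP -> //.
have /esym := mass_split P mtau setT (no_change [set k]%SET h) mC.
rewrite setTI (mass_full theta0 theta1 mtau mX law)// (filteredP [set k]%SET hC).
have -> : P C = (\int[P]_(w in C) (survival [set k]%SET h w)%:E +
    \int[P]_(w in C) (post_hist h w k)%:E)%E.
  rewrite -ge0_integralD//.
  - rewrite -[LHS]mul1e -integral_cst//; apply: eq_integral => w _.
    by rewrite /survival big_set1 -EFinD subrK.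
  - by move=> w _; rewrite lee_fin survival_ge0.
  - by apply: (@mf_int h); exact: hist_survival.
  - by move=> w _; rewrite lee_fin; have /andP[] := post_at_itv k t w.
  - by apply: (@mf_int h (fun w => post_hist h w k)); exact: hist_post.
apply: adde_inj_fin; rewrite -(filteredP [set k]%SET hC) fin_num_measure//.
by apply: measurableI => //; exact: measurable_atoms.
Qed.

(** The posteriors form a Markov process with transition [observe]: this links the Bellman recursion
    to the data. *)
Lemma predict_observe C k h c g : <<s rects h >> C -> nice c g ->
  (\int[P]_(w in C) g (post_hist (k :: h) w) =
   \int[P]_(w in C) observe rho p q theta k g (post_hist h w))%E.
Proof.
move=> hC [mg gc]; have g0 v : (0 <= g v)%E by have /andP[] := gc v.
set t := count_mem k h.
pose G (z : T * Xs) : \bar R := ((fun z : T * Xs =>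
  g (update (post_hist h z.1) k (posterior p q (U h k z.1) z.2))) \_ (C `*` setT)) z.
have G0 z : (0 <= G z)%E by apply: erestrict_ge0.
have mG : measurable_fun (setT : set (Hist h * Xs)%type) G.
  have mCD : measurable (C `*` setT : set (Hist h * Xs)%type) by exact: measurableX.
  apply: measurable_fun_restrictT mCD _.
  pose f j (z : (Hist h * Xs)%type) :=
    if j == k then posterior p q (U h k z.1) z.2 else post_hist h z.1 j.
  apply: (mg _ _ f) => j; rewrite /f; case: (j == k).
    by apply: measurable_posterior => //; exact: mU1.
  exact: (@mfst h (fun w => post_hist h w j) (@hist_post h j)).
transitivity (\int[P]_w G (w, X k t.+1 w))%E.
  rewrite [LHS]integral_mkcond; apply: eq_integral => w _.
  by rewrite /G !patchE in_setX in_setT andbT post_hist_cons.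
rewrite (predict_fun k (@filteredP h) mG G0) [RHS]integral_mkcond.
apply: eq_integral => w _; rewrite patchE; case: ifPn => wC; last first.
  by rewrite integral0_eq// => x _; rewrite /G patchE in_setX (negbTE wC) mul0e.
by apply: eq_integral => x _; rewrite /G patchE in_setX wC in_setT.
Qed.

Lemma predict_observe_seq C l h c g : <<s rects h >> C -> nice c g ->
  (\int[P]_(w in C) g (post_hist (l ++ h) w) =
   \int[P]_(w in C) observe_seq rho p q theta l g (post_hist h w))%E.
Proof.
move=> hC; elim: l g => //= k l IH g ng.
have hC' : <<s rects (l ++ h) >> C by elim: l {IH} => //= j l IH; exact: hist_cons.
by rewrite (predict_observe k hC' ng) IH//; exact: nice_observe.
Qed.

End Filtering.

(** * Procedures *)

Section Integration.
Context {R : realType} {d : measure_display} {T : measurableType d} (P : probability T R).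

(** Gives the almost sure comparisons of versions: it is applied to the set where the desired
    inequality fails. *)
Lemma integral_gt_null (C : set T) (f g : T -> R) : measurable C ->
  P.-integrable setT (EFin \o f) -> P.-integrable setT (EFin \o g) ->
  (forall w, C w -> g w < f w) ->
  (\int[P]_(w in C) (f w)%:E <= \int[P]_(w in C) (g w)%:E)%E -> P C = 0%E.
Proof.
move=> mC fi gi gf fg.
have fiC := integrableS measurableT mC (@subsetT _ C) fi.
have giC := integrableS measurableT mC (@subsetT _ C) gi.
have e0 : (\int[P]_(w in C) `|(f w)%:E - (g w)%:E| = 0)%E.
  under eq_integral => w /[!inE] Cw do rewrite gee0_abs ?sube_ge0 ?lee_fin ?ltW ?gf//.
  rewrite integralB//; apply/eqP; rewrite eq_le sube_le0 fg/=.
  rewrite -integralB//; apply: integral_ge0 => w Cw.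
  by rewrite sube_ge0// lee_fin ltW// gf.
have mh : measurable_fun C (fun w => (f w)%:E - (g w)%:E)%E.
  by apply: emeasurable_funB; apply: measurable_int; eassumption.
have /(ae_eq_integral_abs _ mC mh) := e0.
move=> [N [mN N0 CN]]; apply: (subset_measure0 mC mN _ N0) => w Cw; apply: CN => /= h.
by have := h Cw; rewrite /= -EFinB => -[] /eqP; rewrite subr_eq0 gt_eqF// gf.
Qed.

Lemma integrable_bounded (f : T -> R) : measurable_fun setT f -> (forall w, 0 <= f w <= 1) ->
  P.-integrable setT (EFin \o f).
Proof.
move=> mf f01; apply: (@le_integrable _ _ _ P setT measurableT _ (EFin \o cst 1)).
- exact/measurable_EFinP.
- by move=> w _ /=; have /andP[l u] := f01 w; rewrite lee_fin !ger0_norm.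
- exact: finite_measure_integrable_cst.
Qed.

Lemma integral_sumZ {I : finType} (s : {set I}) (C : set T) (f : I -> T -> R) (c : R) :
  measurable C -> (forall k, P.-integrable setT (EFin \o f k)) ->
  (\int[P]_(w in C) ((\sum_(k in s) f k w) / c)%:E =
   (c^-1)%:E * \sum_(k in s) \int[P]_(w in C) (f k w)%:E)%E.
Proof.
move=> mC fi.
have fiC k : P.-integrable C (EFin \o f k) by exact: integrableS (fi k).
transitivity (\int[P]_(w in C) ((c^-1)%:E * (\sum_(k in s) (EFin \o f k) w)))%E.
  by apply: eq_integral => w _; rewrite mulrC EFinM sumEFin.
rewrite integralZl//; last exact: integrable_sum.
by rewrite integral_sum.
Qed.

Lemma integrable_sumZ {I : finType} (s : {set I}) (f : I -> T -> R) (c : R) :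
  (forall k, P.-integrable setT (EFin \o f k)) ->
  P.-integrable setT (EFin \o (fun w => (\sum_(k in s) f k w) / c)).
Proof.
move=> fi; rewrite (_ : _ \o _ = (fun w => (c^-1)%:E * \sum_(k in s) (EFin \o f k) w))%E.
  by apply: integrableZl => //; exact: integrable_sum.
by apply/funext => w /=; rewrite mulrC EFinM sumEFin.
Qed.

Lemma integral_switch {I : finType} (N : T -> I) (C : set T) (f : T -> \bar R) :
  (forall r, measurable [set w | N w = r]) -> measurable C -> measurable_fun setT f ->
  (forall w, (0 <= f w)%E) ->
  (\int[P]_(w in C) f w = \sum_r \int[P]_(w in C `&` [set w | N w = r]) f w)%E.
Proof.
move=> mN mC mf f0.
under [RHS]eq_bigr do rewrite integral_mkcondr.
rewrite -ge0_integral_sum//; last 2 first.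
- by move=> r; apply: measurable_funTS; exact: measurable_fun_restrictT.
- by move=> r w _; apply: erestrict_ge0.
apply: eq_integral => w _; rewrite (bigD1 (N w))//= big1 ?adde0; last first.
  by move=> r rN; rewrite patchE memNset//= => /esym/eqP; rewrite (negbTE rN).
by rewrite patchE mem_set.
Qed.

End Integration.

Section Procedure.
Context {K : nat} {d : measure_display} {T : measurableType d}
  {dX : measure_display} {Xs : measurableType dX} (X : 'I_K -> nat -> T -> Xs).
Hypothesis mX : forall k t, measurable_fun setT (X k t).
Implicit Type S : nat -> T -> {set 'I_K}.

Lemma filtr_sigma_algebra S t : (0 < t)%N -> <<s filtr X S t>> = filtr X S t.
Proof.
case: t => // t _; apply: sigma_algebra_id; exact: smallest_sigma_algebra.
Qed.

Lemma filtr_mono S t : filtr X S t `<=` filtr X S t.+1.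
Proof. by move=> A FA; apply: sub_sigma_algebra; left. Qed.

Lemma filtr_active S t s : (0 < t)%N -> filtr X S t [set w | S t w = s].
Proof. by case: t => // t _; apply: sub_sigma_algebra; right; left; exists s. Qed.

Lemma eq_filtr S S' t : (forall s w, (1 <= s <= t)%N -> S s w = S' s w) ->
  filtr X S t = filtr X S' t.
Proof.
elim: t => // t IH e /=; rewrite IH; last first.
  by move=> s w /andP[s0 st]; apply: e; rewrite s0 ltnW.
have eS : S t.+1 = S' t.+1 by apply/funext => w; apply: e; rewrite leqnn.
by rewrite /gens eS.
Qed.

Lemma active_bigcup S t k (D : set T) :
  [set w | k \in S t w] `&` D = \bigcup_(s in [set s : {set 'I_K} | k \in s]) ([set w | S t w = s] `&` D).
Proof.
apply/seteqP; split=> w /=; first by case=> kS Dw; exists (S t w).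
by move=> [s ks [Ss Dw]]; split => //; rewrite Ss.
Qed.

End Procedure.

Section Rule.
Context {R : realType} {K : nat} {d : measure_display} {T : measurableType d} (P : probability T R)
  {dX : measure_display} {Xs : measurableType dX} (tau : 'I_K -> T -> option nat)
  (X : 'I_K -> nat -> T -> Xs) (alpha : R).
Hypothesis mX : forall k t, measurable_fun setT (X k t).
Hypothesis mtau : forall k m, measurable [set w | tau k w = m].
Hypothesis alpha0 : 0 <= alpha.
Implicit Type S : nat -> T -> {set 'I_K}.

Local Notation Fil S t := (g_sigma_algebraType (filtr X S t)).

Lemma filtr_setI S t A B : (0 < t)%N -> filtr X S t A -> filtr X S t B ->
  filtr X S t (A `&` B).
Proof.
move=> t0 FA FB; rewrite -(filtr_sigma_algebra X S t0).
by apply: (@measurableI _ (Fil S t)); exact: sub_sigma_algebra.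
Qed.

Lemma Gmeas_measurable S t (Z : T -> R) : (0 < t)%N ->
  Gmeas (filtr X S t) Z <-> measurable_fun (setT : set (Fil S t)) Z.
Proof.
move=> t0; split=> [GZ _ B mB|mZ B mB].
  by rewrite setTI; apply: sub_sigma_algebra; exact: GZ.
rewrite -(filtr_sigma_algebra X S t0).
by have := mZ measurableT B mB; rewrite setTI.
Qed.

Lemma filtr_measurable S : is_proc X S -> forall t A, filtr X S t A -> measurable A.
Proof.
move=> [S1 _ mS]; elim=> [A [->|->]//|t IH] A.
have mSt s : measurable [set w | S t.+1 w = s].
  case: t IH => [_|t IH]; last exact/IH/mS.
  have [->|sT] := eqVneq s [set: 'I_K]%SET.
    by rewrite [X in measurable X](_ : _ = setT)//; apply/seteqP; split => w // _; exact: S1.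
  rewrite [X in measurable X](_ : _ = set0)//; apply/seteqP; split => w //=.
  by rewrite S1 => /esym/eqP; rewrite (negbTE sT).
apply: (@smallest_sub _ _ _ (@measurable _ T)); first exact: sigma_algebra_measurable.
move=> B [/IH//|[[s ->]|[k [D [mD ->]]]]]; first exact: mSt.
rewrite -[X in measurable X]/([set w | k \in S t.+1 w] `&` (X k t.+1 @^-1` D)).
rewrite active_bigcup; apply: fin_bigcup_measurable; first exact: finite_finset.
move=> s _; apply: measurableI; first exact: mSt.
by rewrite -[X in measurable X]setTI; exact: mX.
Qed.

Lemma proc_measurable S : is_proc X S ->
  forall s, (0 < s)%N -> forall r, measurable [set w | S s w = r].
Proof. by move=> pS s s0 r; exact/(filtr_measurable pS)/filtr_active. Qed.

Lemma null_switch {I : finType} (N : T -> I) (C : set T) :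
  (forall r, measurable [set w | N w = r]) -> measurable C ->
  (forall r, P (C `&` [set w | N w = r]) = 0%E) -> P C = 0%E.
Proof.
move=> mN mC C0; rewrite -[LHS]mul1e -integral_cst// (integral_switch P mN mC)//.
rewrite big1// => r _; rewrite integral_cst; last exact: measurableI.
by rewrite mul1e; exact: C0.
Qed.

Lemma integrable_tau_lt k t : P.-integrable setT (EFin \o (fun w => (tau_lt (tau k w) t)%:R : R)).
Proof.
apply: integrable_bounded; last by move=> w; case: tau_lt; rewrite ?lexx ler01.
rewrite (_ : (fun w => _) = \1_[set w | tau_lt (tau k w) t]).
  by apply: measurable_indic; exact: measurable_tau_lt.
apply/funext => w; rewrite indicE; congr (_%:R); congr nat_of_bool.
by apply/idP/idP => [|/set_mem//]; move=> h; rewrite mem_set.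
Qed.

Definition rule_step S (W : 'I_K -> T -> R) t :=
  (forall k, is_cexp P (filtr X S t) (fun w => (tau_lt (tau k w) t)%:R) (W k)) /\
  (forall w, S t.+1 w = rule alpha (S t w) (fun k => W k w)).

(** On the event that [Z] exceeds [alpha] and the next active set is [s], the integral of [Z] is
    that of the average of [W] over [s], which the rule keeps below [alpha]; so the event is
    null. *)
Lemma rule_step_LFNR S W t Z : is_proc X S -> (0 < t)%N -> rule_step S W t ->
  is_cexp P (filtr X S t) (FNP tau S t) Z -> {ae P, forall w, Z w <= alpha}.
Proof.
move=> pS t0 [cW SW] [GZ iZ EZ].
have mS := proc_measurable pS.
have GC : filtr X S t [set w | alpha < Z w].
  rewrite -[X in filtr _ _ _ X](_ : Z @^-1` `]alpha, +oo[ = _); first exact: GZ.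
  by apply/seteqP; split => w /=; rewrite in_itv/= andbT.
have mC := filtr_measurable pS GC.
exists [set w | alpha < Z w]; split => //; last by move=> w /= /negP; rewrite -ltNge.
apply: (null_switch (N := S t.+1)) => // [|s]; first exact: mS.
set E := _ `&` _.
have GE : filtr X S t E by apply: filtr_setI => //; case: pS => _ _; exact.
have mE := filtr_measurable pS GE.
pose c : R := (maxn #|s| 1)%:R.
have iW k : P.-integrable setT (EFin \o W k) by case: (cW k).
apply: (integral_gt_null (f := Z) (g := fun=> alpha)) => //.
- exact: finite_measure_integrable_cst.
- by move=> w [].
rewrite EZ//.
have -> : (\int[P]_(w in E) (FNP tau S t w)%:E =
    \int[P]_(w in E) ((\sum_(k in s) (tau_lt (tau k w) t)%:R) / c)%:E)%E.
  by apply: eq_integral => w /[!inE] -[_ Sw]; rewrite /FNP Sw.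
rewrite (@integral_sumZ _ _ _ P _ s E (fun k w => (tau_lt (tau k w) t)%:R))//; last first.
  by move=> k; exact: integrable_tau_lt.
under eq_bigr => k _ do have [_ _ /(_ E GE) <-] := cW k.
rewrite -integral_sumZ//.
apply: le_integral => //.
- by apply: (integrableS measurableT) => //; exact: integrable_sumZ.
- by apply: (integrableS measurableT) => //; exact: finite_measure_integrable_cst.
move=> w /[!inE] -[_ Sw]; rewrite lee_fin.
(* Passing from the cardinal to its maximum with 1, which matters for an empty selection, uses
   [0 <= alpha]. *)
have := excess_rule alpha (S t w) (fun k => W k w); rewrite -SW Sw /excess sumrB subr_le0.
rewrite sumr_const => h; rewrite ler_pdivrMr; last by rewrite ltr0n leq_max orbT.
by apply: (le_trans h); rewrite -mulr_natr ler_wpM2l// ler_nat leq_maxl.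
Qed.

Lemma switch_proc A t0 G : is_proc X A -> is_switch P tau X alpha A t0 G -> is_proc X G.
Proof.
move=> [A1 A2 A3] [G1 GA [W GW]].
have lt_ge t : (1 <= t)%N -> (t < t0)%N \/ (maxn t0 1 <= t)%N.
  by move=> t1; rewrite geq_max t1 andbT; case: (ltnP t t0); [left|right].
split => // [t w t1|t s t1].
  have [tt0|/GW [_ ->]] := lt_ge t t1; last exact: rule_sub.
  by rewrite !GA ?t1 ?(ltnW tt0)//; exact: A2.
have [tt0|tt0] := lt_ge t t1.
  rewrite (_ : filtr X G t = filtr X A t); last by apply: eq_filtr => r w /andP[r1 rt]; rewrite GA// r1 (leq_trans rt)// ltnW.
  rewrite [X in filtr _ _ _ X](_ : _ = [set w | A t.+1 w = s]); first exact: A3.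
  by apply/seteqP; split => w /=; rewrite GA.
have [cW GE] := GW t tt0.
rewrite [X in filtr _ _ _ X](_ : _ = [set w | rule alpha (G t w) (fun k => W t k w) = s]); last first.
  by apply/seteqP; split => w /=; rewrite GE.
rewrite -(filtr_sigma_algebra X G t1).
apply: (@measurable_rule _ (Fil G t)) => [r|k].
  by apply: sub_sigma_algebra; exact: filtr_active.
by apply/Gmeas_measurable => //; case: (cW k).
Qed.

Lemma switch_in_Talpha A t0 G : in_Talpha P tau X alpha A ->
  is_switch P tau X alpha A t0 G -> in_Talpha P tau X alpha G.
Proof.
move=> [pA TA] sG; have pG := switch_proc pA sG; split => // t t1 Z.
have [G1 GA [W GW]] := sG.
have [tt0|tt0] := ltnP t t0; last first.
  by apply: (@rule_step_LFNR _ (W t)) => //; apply: GW; rewrite geq_max tt0.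
rewrite (_ : filtr X G t = filtr X A t); last by apply: eq_filtr => r w /andP[r1 rt]; rewrite GA// r1 (leq_trans rt)// ltnW.
rewrite (_ : FNP tau G t = FNP tau A t); first exact: TA.
by apply/funext => w; rewrite /FNP GA.
Qed.

End Rule.

(** * Optimality *)

Section Optimality.
Context {R : realType} {K : nat} {d : measure_display} {T : measurableType d} (P : probability T R)
  {dX : measure_display} {Xs : measurableType dX} (rho : {finite_measure set Xs -> \bar R})
  (p q : Xs -> R) (theta alpha : R) (tau : 'I_K -> T -> option nat) (X : 'I_K -> nat -> T -> Xs).
Hypotheses (theta0 : 0 < theta) (theta1 : theta < 1).
Hypotheses (p0 : forall x, 0 <= p x) (q0 : forall x, 0 <= q x).
Hypotheses (mp : measurable_fun setT p) (mq : measurable_fun setT q).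
Hypotheses (p1 : (\int[rho]_x (p x)%:E = 1)%E) (q1 : (\int[rho]_x (q x)%:E = 1)%E).
Hypothesis mtau : forall k m, measurable [set w | tau k w = m].
Hypothesis mX : forall k t, measurable_fun setT (X k t).
Hypothesis law : forall (v : {ffun 'I_K -> nat}) (F : seq ('I_K * nat)) (B : 'I_K * nat -> set Xs),
  uniq F -> (forall kt, kt \in F -> (0 < kt.2)%N) -> (forall kt, measurable (B kt)) ->
  P (atom tau v `&` [set w | forall kt, kt \in F -> B kt (X kt.1 kt.2 w)]) =
  ((\prod_k (theta * (1 - theta) ^+ v k)%R)%:E *
  \prod_(kt <- F) \int[rho]_(x in B kt) (if (v kt.1 < kt.2)%N then q x else p x)%:E)%E.
Implicit Types (S : nat -> T -> {set 'I_K}) (k : 'I_K).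

Let post t w k : R := post_at p q theta X k t w.

Let post01 t w k : 0 <= post t w k <= 1. Proof. exact: post_at_itv. Qed.

(* The full history at time [t]: one observation of every stream per round. *)
Definition rounds t : seq 'I_K := iter t (cat (enum 'I_K)) [::].

Lemma count_rounds k t : count_mem k (rounds t) = t.
Proof.
elim: t => //= t IH; rewrite count_cat IH count_uniq_mem ?enum_uniq//.
by rewrite mem_enum.
Qed.

Let post_rounds t w : post_hist p q theta X (rounds t) w = post t w.
Proof. by apply/funext => k; rewrite /post_hist count_rounds. Qed.

Local Notation Fil S t := (g_sigma_algebraType (filtr X S t)).
Local Notation Hist t := (g_sigma_algebraType (rects X (rounds t))).

Lemma rounds_mono t A : <<s rects X (rounds t) >> A -> <<s rects X (rounds t.+1) >> A.
Proof.
by move=> hA; rewrite /=; elim: (enum 'I_K) => //= k l IH; exact: hist_cons.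
Qed.

(** Every procedure uses part of the full data, so one posterior process [post] serves them all. *)
Lemma filtr_rounds S t A : is_proc X S -> filtr X S t A -> <<s rects X (rounds t) >> A.
Proof.
move=> [S1 S2 S3]; elim: t A => [A [->|->]|t IH A].
- exact: (@measurable0 _ (Hist 0)).
- exact: (@measurableT _ (Hist 0)).
have hS s : <<s rects X (rounds t.+1) >> [set w | S t.+1 w = s].
  case: t IH => [_|t IH]; last by apply: rounds_mono; apply: IH; exact: S3.
  have [->|sT] := eqVneq s [set: 'I_K]%SET.
    rewrite [X in <<s _ >> X](_ : _ = setT); first exact: (@measurableT _ (Hist 1)).
    by apply/seteqP; split => w // _; exact: S1.
  rewrite [X in <<s _ >> X](_ : _ = set0); first exact: (@measurable0 _ (Hist 1)).
  by apply/seteqP; split => w //=; rewrite S1 => /esym/eqP; rewrite (negbTE sT).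
apply: (@smallest_sub _ _ _ <<s rects X (rounds t.+1) >>); first exact: smallest_sigma_algebra.
move=> B [/IH/rounds_mono//|[[s ->]|[k [D [mD ->]]]]]; first exact: hS.
rewrite -[X in <<s _ >> X]/([set w | k \in S t.+1 w] `&` (X k t.+1 @^-1` D)) active_bigcup.
apply: (@fin_bigcup_measurable _ (Hist t.+1)); first exact: finite_finset.
move=> s _; apply: (@measurableI _ (Hist t.+1)); first exact: hS.
have sh : (0 < t.+1 <= count_mem k (rounds t.+1))%N by rewrite count_rounds leqnn.
have mXk : measurable_fun (setT : set (Hist t.+1)) (X k t.+1) by exact: hist_obs.
by have := mXk measurableT D mD; rewrite setTI.
Qed.

Let mpost t k : measurable_fun setT (fun w => post t w k).
Proof.
apply: (hist_measurable_fun mX (h := rounds t)).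
by apply: hist_post_at => //; rewrite count_rounds.
Qed.

(* [F_t] determines the full-history posterior [post] only on the active streams. *)
Let active_post S t k w : R := if k \in S t w then post t w k else 0.

Let filtr_active_in S t k : (0 < t)%N -> measurable ([set w | k \in S t w] : set (Fil S t)).
Proof.
move=> t0; rewrite -[X in measurable X]setIT active_bigcup.
apply: fin_bigcup_measurable; first exact: finite_finset.
by move=> s _; rewrite setIT; apply: sub_sigma_algebra; exact: filtr_active.
Qed.

(** An active stream was active at all earlier times, so its whole past is in the filtration, and
    [post] involves nothing else. *)
Lemma filtr_active_post S t k : is_proc X S -> (0 < t)%N ->
  measurable_fun (setT : set (Fil S t)) (active_post S t k).
Proof.
move=> pS; have [_ S2 S3] := pS; move=> t0.
suff mD : measurable_fun ([set w | k \in S t w] : set (Fil S t)) (fun w => post t w k).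
  apply: measurable_fun_if => //.
  - apply: (measurable_fun_bool true); rewrite setTI.
    rewrite [X in measurable X](_ : _ = [set w | k \in S t w]); first exact: filtr_active_in.
    by apply/seteqP; split => w.
  - by rewrite setTI.
elim: t t0 => // t IH _.
have mXD : measurable_fun ([set w | k \in S t.+1 w] : set (Fil S t.+1)) (X k t.+1).
  move=> _ B mB; apply: sub_sigma_algebra; apply: sub_sigma_algebra.
  by right; right; exists k, B.
apply: measurable_posterior => //; first by move=> w; exact: prior_itv.
apply: measurable_prior; case: t IH mXD => [_ _|t IH _]; first exact: measurable_cst.
move=> mD B mB.
have := IH isT (filtr_active_in _ _) B mB; set A := _ `&` _ => hA.
rewrite (_ : _ `&` _ = [set w | k \in S t.+2 w] `&` A).
  apply: measurableI => //.
  apply: sub_sigma_algebra; apply: filtr_mono.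
  by rewrite -(filtr_sigma_algebra X S (ltn0Sn t)); exact: hA.
by rewrite /A setIA; congr (_ `&` _); apply/esym/setIidPl => w /=; exact/fintype.subsetP/S2.
Qed.

Let mactive S t k : is_proc X S -> (0 < t)%N -> measurable_fun setT (active_post S t k).
Proof.
move=> pS t0 _ B mB; rewrite setTI; apply: (filtr_measurable mX pS (t := t)).
by have [_] := Gmeas_measurable X S (active_post S t k) t0; apply => //; exact: filtr_active_post.
Qed.

Let active_post01 S t k w : 0 <= active_post S t k w <= 1.
Proof. by rewrite /active_post; case: ifP => _; [exact: post01|rewrite lexx ler01]. Qed.

Let iactive S t k : is_proc X S -> (0 < t)%N -> P.-integrable setT (EFin \o active_post S t k).
Proof. by move=> pS t0; apply: integrable_bounded => //; exact: mactive. Qed.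

Lemma integral_active_post S t k E : is_proc X S -> (0 < t)%N -> filtr X S t E ->
  (forall w, E w -> k \in S t w) ->
  (\int[P]_(w in E) (active_post S t k w)%:E =
   \int[P]_(w in E) ((tau_lt (tau k w) t)%:R)%:E)%E.
Proof.
move=> pS t0 FE Ek; have hE := filtr_rounds pS FE; have mE := filtr_measurable mX pS FE.
transitivity (\int[P]_(w in E) (post_hist p q theta X (rounds t) w k)%:E)%E.
  by apply: eq_integral => w /[!inE] /Ek kS; rewrite post_rounds /active_post kS.
rewrite -(posterior_change theta0 theta1 p0 q0 mp mq p1 q1 mtau mX law k hE) count_rounds.
have mt := measurable_tau_lt t (mtau k).
rewrite setIC -integral_indic//; apply: eq_integral => w _; rewrite indicE.
congr (_%:R)%:E; congr nat_of_bool.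
by apply/idP/idP => [/set_mem//|h]; rewrite mem_set.
Qed.

(** The average of [post] over the next active set is a version of the LFNR, hence at most [alpha]
    almost surely. *)
Lemma Talpha_excess S t : in_Talpha P tau X alpha S -> (0 < t)%N ->
  {ae P, forall w, excess alpha (S t.+1 w) (post t w) <= 0}.
Proof.
move=> [pS TS] t0; have [_ S2 S3] := pS.
have mS := proc_measurable mX pS.
pose c (s : {set 'I_K}) : R := (maxn #|s| 1)%:R.
have c0 s : 0 < c s by rewrite ltr0n leq_max orbT.
pose G (s : {set 'I_K}) w : R := (\sum_(k in s) active_post S t k w) / c s.
pose Z w := G (S t.+1 w) w.
have G01 s w : 0 <= G s w <= 1.
  rewrite divr_ge0 ?(ltW (c0 s)) ?sumr_ge0//=; last by move=> k _; have /andP[] := active_post01 S t k w.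
  rewrite ler_pdivrMr// mul1r; apply: (@le_trans _ _ (\sum_(k in s) 1)).
    by apply: ler_sum => k _; have /andP[] := active_post01 S t k w.
  by rewrite sumr_const ler_nat leq_maxl.
have mZ : measurable_fun (setT : set (Fil S t)) Z.
  apply: (@measurable_fun_switch _ (Fil S t) _ _ _ (S t.+1) G) => s.
    by apply: sub_sigma_algebra; exact: S3.
  apply: measurable_funM => //.
  rewrite (_ : (fun w => _) = (fun w => \sum_(k <- enum s) active_post S t k w)).
    by apply: measurable_sum => k; exact: filtr_active_post.
  by apply/funext => w; rewrite big_enum.
have GZ : Gmeas (filtr X S t) Z by apply/Gmeas_measurable.
have mZT : measurable_fun setT Z.
  by move=> _ B mB; rewrite setTI; apply: (filtr_measurable mX pS (t := t)); exact: GZ.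
have F01 w : 0 <= (FNP tau S t w : R) <= 1.
  rewrite divr_ge0 ?sumr_ge0//= ler_pdivrMr ?c0// mul1r.
  apply: (@le_trans _ _ (\sum_(k in S t.+1 w) 1)).
    by apply: ler_sum => k _; case: tau_lt.
  by rewrite sumr_const ler_nat leq_maxl.
have mF : measurable_fun setT (FNP tau S t : T -> R).
  apply: (measurable_fun_switch (N := S t.+1)
    (G := fun s w => (\sum_(k in s) (tau_lt (tau k w) t)%:R) / c s)) => s; first exact: mS.
  have := integrable_sumZ s (c s) (fun k => integrable_tau_lt P mtau k t).
  by move=> /measurable_int/measurable_EFinP.
have /(TS t t0) : is_cexp P (filtr X S t) (FNP tau S t) Z.
  split => //; first by apply: integrable_bounded => // w; exact: G01.
  move=> C FC; have mC := filtr_measurable mX pS FC.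
  rewrite (integral_switch P (N := S t.+1) _ mC); last 3 first.
  - exact: mS.
  - exact/measurable_EFinP.
  - by move=> w; rewrite lee_fin; have /andP[] := G01 (S t.+1 w) w.
  rewrite [RHS](integral_switch P (N := S t.+1) _ mC); last 3 first.
  - exact: mS.
  - exact/measurable_EFinP.
  - by move=> w; rewrite lee_fin; have /andP[] := F01 w.
  apply: eq_bigr => s _; set E := C `&` _.
  have FE : filtr X S t E by apply: filtr_setI => //; exact: S3.
  have mE := filtr_measurable mX pS FE.
  transitivity (\int[P]_(w in E) ((\sum_(k in s) active_post S t k w) / c s)%:E)%E.
    by apply: eq_integral => w /[!inE] -[_ Sw]; rewrite /Z Sw.
  rewrite integral_sumZ//; last by move=> k; exact: iactive.
  transitivity (\int[P]_(w in E) ((\sum_(k in s) (tau_lt (tau k w) t)%:R) / c s)%:E)%E; last first.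
    by apply: eq_integral => w /[!inE] -[_ Sw]; rewrite /FNP Sw.
  rewrite (@integral_sumZ _ _ _ P _ s E (fun k w => (tau_lt (tau k w) t)%:R))//; last first.
    by move=> k; exact: integrable_tau_lt.
  congr (_ * _)%E; apply: eq_bigr => k ks; apply: integral_active_post => // w [_ Sw].
  by apply: (fintype.subsetP (S2 t w t0)); rewrite Sw.
apply: filterS => w; rewrite /Z /G ler_pdivrMr// => h.
rewrite /excess sumrB subr_le0 sumr_const.
have -> : \sum_(k in S t.+1 w) post t w k = \sum_(k in S t.+1 w) active_post S t k w.
  by apply: eq_bigr => k /(fintype.subsetP (S2 t w t0)) kS; rewrite /active_post kS.
have [S0|[k kS]] := set_0Vmem (S t.+1 w); first by rewrite S0 big_set0 cards0 mulr0n.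
move: h; rewrite /c (maxn_idPl _) ?mulr_natr//.
by rewrite card_gt0; apply/set0Pn; exists k.
Qed.

(** The rule is run with arbitrary versions [W] of the posteriors. They agree almost surely with
    [post] on active streams, and the rule looks at no others. *)
Lemma rule_step_post S W t : is_proc X S -> (0 < t)%N -> rule_step P tau X alpha S W t ->
  {ae P, forall w, S t.+1 w = rule alpha (S t w) (post t w)}.
Proof.
move=> pS t0 [cW SW].
have aeW k : {ae P, forall w, k \in S t w -> W k w = post t w k}.
  have [GW iW EW] := cW k.
  have mW : measurable_fun (setT : set (Fil S t)) (W k) by exact/Gmeas_measurable.
  have mA := filtr_active_post k pS t0.
  have FD : filtr X S t [set w | k \in S t w].
    by rewrite -(filtr_sigma_algebra X S t0); exact: filtr_active_in.
  (* One-sided, and used in both directions: the set where [g < f] on active [k] is in the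
     filtration, so the integrals may be compared on it. *)
  have null (f g : T -> R) : measurable_fun (setT : set (Fil S t)) f ->
      measurable_fun (setT : set (Fil S t)) g ->
      P.-integrable setT (EFin \o f) -> P.-integrable setT (EFin \o g) ->
      (forall E, filtr X S t E -> (forall w, E w -> k \in S t w) ->
        (\int[P]_(w in E) (f w)%:E = \int[P]_(w in E) (g w)%:E)%E) ->
      P ([set w | k \in S t w] `&` [set w | g w < f w]) = 0%E /\
      measurable ([set w | k \in S t w] `&` [set w | g w < f w]).
    move=> mf mg fi gi fg.
    have FE : filtr X S t ([set w | k \in S t w] `&` [set w | g w < f w]).
      apply: filtr_setI => //; rewrite -(filtr_sigma_algebra X S t0).
      have m1 : measurable_fun (setT : set (Fil S t)) (fun w => g w < f w).
        exact: measurable_fun_ltr.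
      have mtrue : measurable [set true] by [].
      by have := m1 measurableT _ mtrue; rewrite setTI.
    have mE := filtr_measurable mX pS FE; split => //.
    apply: (integral_gt_null (f := f) (g := g)) => // [w []//|].
    by rewrite fg// => w [].
  have iA := iactive k pS t0.
  have EE E : filtr X S t E -> (forall w, E w -> k \in S t w) ->
      (\int[P]_(w in E) (W k w)%:E = \int[P]_(w in E) (active_post S t k w)%:E)%E.
    by move=> FE Ek; rewrite integral_active_post// EW.
  have [n1 m1] := null _ _ mW mA iW iA EE.
  have [n2 m2] := null _ _ mA mW iA iW (fun E FE Ek => esym (EE E FE Ek)).
  exists (([set w | k \in S t w] `&` [set w | active_post S t k w < W k w]) `|`
          ([set w | k \in S t w] `&` [set w | W k w < active_post S t k w])).
  split; [exact: measurableU|exact: null_set_setU|].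
  move=> w /= h; have [kS|kS] := boolP (k \in S t w); last by case: h; rewrite (negbTE kS).
  have e : active_post S t k w = post t w k by rewrite /active_post kS.
  have [lt|lt|eW] := ltgtP (active_post S t k w) (W k w); [by left|by right|].
  by case: h => _; rewrite -eW.
have : {ae P, forall w, forall k, k \in S t w -> W k w = post t w k}.
  by apply: filter_forall => k; exact: aeW.
by apply: filterS => w h; rewrite SW; apply: eq_rule => k; exact: h.
Qed.

Local Notation val n s v := (value rho p q theta alpha n s v).
Local Notation obs_all n s v := (observe_seq rho p q theta (enum 'I_K) (value rho p q theta alpha n s) v).

Let nice_val n (s : {set 'I_K}) : nice (n * K)%:R (value rho p q theta alpha n s).
Proof. exact: nice_value. Qed.

Let nice_obs n (s : {set 'I_K}) : nice (n * K)%:R (observe_seq rho p q theta (enum 'I_K) (value rho p q theta alpha n s)).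
Proof. exact: nice_observe_seq. Qed.

Let nice_ge0 c (g : ('I_K -> R) -> \bar R) v : nice c g -> (0 <= g v)%E.
Proof. by move=> [_ gc]; have /andP[] := gc v. Qed.

Let mnice {N : T -> {set 'I_K}} {c} {g : {set 'I_K} -> ('I_K -> R) -> \bar R} t :
  (forall r, measurable [set w | N w = r]) -> (forall s, nice c (g s)) ->
  measurable_fun setT (fun w => g (N w) (post t w)).
Proof.
move=> mN ng; apply: (measurable_fun_switch (G := fun s w => g s (post t w))) => // s.
by have [mg _] := ng s; apply: (mg _ _ (fun k w => post t w k)) => k; exact: mpost.
Qed.

Let mcard {N : T -> {set 'I_K}} : (forall r, measurable [set w | N w = r]) ->
  measurable_fun setT (fun w => (#|N w|%:R%:E : \bar R)).
Proof.
move=> mN; apply: (measurable_fun_switch (N := N) (G := fun (s : {set 'I_K}) (w : T) => (#|s|%:R%:E : \bar R))) => //.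
Qed.

(** [S t.+1] is decided by the first [t] rounds, so on each of its level sets round [t.+1] is
    averaged with a fixed active set. At [t = 0] the level sets are trivial. *)
Lemma integral_value S n t : is_proc X S ->
  (\int[P]_w val n (S t.+1 w) (post t.+1 w) = \int[P]_w obs_all n (S t.+1 w) (post t w))%E.
Proof.
move=> pS; have mS := proc_measurable mX pS (ltn0Sn t).
have FS s : <<s rects X (rounds t) >> [set w | S t.+1 w = s] \/ t = 0%N.
  case: t mS => [|t] mS; [by right|left].
  by apply: (filtr_rounds pS); case: pS => _ _; exact.
have RS s : <<s rects X (rounds t) >> [set w | S t.+1 w = s].
  have [//|t0] := FS s; subst t; case: pS => S1 _ _.
  have [->|sT] := eqVneq s [set: 'I_K]%SET.
    rewrite [X in <<s _ >> X](_ : _ = setT); first exact: (@measurableT _ (Hist 0)).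
    by apply/seteqP; split => w // _; exact: S1.
  rewrite [X in <<s _ >> X](_ : _ = set0); first exact: (@measurable0 _ (Hist 0)).
  by apply/seteqP; split => w //=; rewrite S1 => /esym/eqP; rewrite (negbTE sT).
rewrite (integral_switch P (N := S t.+1) mS measurableT); last 2 first.
- exact: (mnice t.+1 mS (nice_val n)).
- by move=> w; exact: nice_ge0 (nice_val n _).
rewrite [RHS](integral_switch P (N := S t.+1) mS measurableT); last 2 first.
- exact: (mnice t mS (nice_obs n)).
- by move=> w; exact: nice_ge0 (nice_obs n _).
apply: eq_bigr => s _; rewrite setTI.
transitivity (\int[P]_(w in [set w | S t.+1 w = s]) val n s (post_hist p q theta X (enum 'I_K ++ rounds t) w))%E.
  by apply: eq_integral => w /[!inE] /= ->; rewrite -[_ ++ _]/(rounds t.+1) post_rounds.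
rewrite (predict_observe_seq theta0 theta1 p0 q0 mp mq p1 q1 mtau mX law _ (RS s) (nice_val n s)).
by apply: eq_integral => w /[!inE] /= ->; rewrite post_rounds.
Qed.

Lemma EU_recr S t : is_proc X S ->
  (EU P S t.+1 = EU P S t + \int[P]_w (#|S t.+1 w|%:R)%:E)%E.
Proof.
move=> pS; have mS := proc_measurable mX pS.
have mU n : measurable_fun setT (fun w => ((util S n w)%:R%:E : \bar R)).
  elim: n => [|n IH].
    by under eq_fun do rewrite /util big_geq//; exact: measurable_cst.
  under eq_fun do rewrite /util big_nat_recr//= natrD EFinD.
  by apply: emeasurable_funD => //; apply: mcard; exact: mS.
rewrite /EU -ge0_integralD//.
- by apply: eq_integral => w _; rewrite -EFinD -natrD /util big_nat_recr.
- by apply: mcard; exact: mS.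
Qed.

(* The expected utilization at time [t + n] of [S] followed up to time [t] and of
   the one-step rule afterwards. *)
Definition reward S n t : \bar R := (EU P S t + \int[P]_w val n (S t w) (post t w))%E.

Lemma reward0 S t : reward S 0 t = EU P S t.
Proof. by rewrite /reward /= integral0 adde0. Qed.

Let reward_stage S n t : is_proc X S ->
  (reward S n t.+1 = EU P S t +
    \int[P]_w stage rho p q theta alpha n (S t.+1 w) (post t w))%E.
Proof.
move=> pS; have mS := proc_measurable mX pS (ltn0Sn t).
rewrite /reward EU_recr// -addeA integral_value// -ge0_integralD//.
- exact: mcard.
- by move=> w _; exact: nice_ge0 (nice_obs n _).
- exact: (mnice t mS (nice_obs n)).
Qed.

Let mstage S n t : is_proc X S ->
  measurable_fun setT (fun w => stage rho p q theta alpha n (S t.+1 w) (post t w)).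
Proof.
move=> pS; have mS := proc_measurable mX pS (ltn0Sn t).
by apply: emeasurable_funD; [exact: mcard|exact: (mnice t mS (nice_obs n))].
Qed.

Let stage_ge0 n (s : {set 'I_K}) v : (0 <= stage rho p q theta alpha n s v)%E.
Proof. by rewrite adde_ge0// (nice_ge0 _ (nice_obs n _)). Qed.

Lemma reward_step S n t : in_Talpha P tau X alpha S -> (0 < t)%N ->
  (reward S n t.+1 <= reward S n.+1 t)%E.
Proof.
move=> TS t0; have [pS _] := TS; have [_ S2 _] := pS; rewrite reward_stage// leeD2l//.
apply: ae_ge0_le_integral => //.
- exact: mstage.
- by move=> w _; exact: nice_ge0 (nice_val _ _).
- exact: (mnice t (proc_measurable mX pS t0) (nice_val n.+1)).
apply: filterS (Talpha_excess TS t0) => w h _.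
by apply: stage_le_value => //; [exact: ltW|exact: S2].
Qed.

Lemma reward_rule_step S W n t : is_proc X S -> (0 < t)%N -> rule_step P tau X alpha S W t ->
  reward S n t.+1 = reward S n.+1 t.
Proof.
move=> pS t0 rS; rewrite reward_stage//; congr (_ + _)%E.
apply: ge0_ae_eq_integral => //.
- exact: mstage.
- exact: (mnice t (proc_measurable mX pS t0) (nice_val n.+1)).
- by move=> w _; exact: nice_ge0 (nice_val _ _).
by apply: filterS (rule_step_post pS t0 rS) => w h _; rewrite h.
Qed.

Lemma rule_step_optimal S S' a : (0 < a)%N -> in_Talpha P tau X alpha S -> is_proc X S' ->
  (forall t w, (0 < t <= a)%N -> S t w = S' t w) ->
  (forall t, (a <= t)%N -> exists W, rule_step P tau X alpha S' W t) ->
  forall t, (EU P S t <= EU P S' t)%E.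
Proof.
move=> a0 TS pS' eS rS' t.
have eEU s : (s <= a)%N -> EU P S s = EU P S' s.
  move=> sa; apply: eq_integral => w _; congr (_%:R%:E); apply: eq_big_nat => r /andP[r0 rs].
  by rewrite eS// r0 (leq_trans _ sa).
have [ta|/ltnW at_] := leqP t a; first by rewrite eEU.
rewrite -!reward0 -(subnKC at_).
(* From time [a] on the reward of [S'] is constant, that of [S] can only decrease with the switching
   time, and at time [a] the two coincide. *)
have E n m : reward S' m (a + n) = reward S' (m + n) a.
  elim: n m => [|n IH] m; first by rewrite !addn0.
  have aan : (a <= a + n)%N by exact: leq_addr.
  have [W rW] := rS' _ aan.
  by rewrite addnS (reward_rule_step m pS' (leq_trans a0 aan) rW) IH addSnnS.
have L n m : (reward S m (a + n) <= reward S (m + n) a)%E.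
  elim: n m => [|n IH] m; first by rewrite !addn0.
  rewrite addnS -addSnnS; apply: le_trans (IH _); apply: reward_step => //.
  exact: leq_trans a0 (leq_addr _ _).
apply: (le_trans (L _ _)); rewrite E /reward eEU//.
by rewrite le_eqVlt; apply/orP; left; apply/eqP; congr (_ + _)%E; apply: eq_integral => w _; rewrite eS ?a0/=.
Qed.

End Optimality.

Theorem theorem5 (R : realType) (K : nat) (d : measure_display) (T : measurableType d)
  (P : probability T R) (dX : measure_display) (Xs : measurableType dX)
  (mu : {measure set Xs -> \bar R})
  (tau : 'I_K -> T -> option nat) (X : 'I_K -> nat -> T -> Xs)
  (pd qd : 'I_K -> nat -> Xs -> R)
  (alpha : R) (A : nat -> T -> {set 'I_K}) (t0 : nat)
  (G0 G1 Gstar : nat -> T -> {set 'I_K}) :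
  (0 < K)%N ->
  gen_model P mu tau X pd qd ->
  0 < alpha <= 1 ->
  in_Talpha P tau X alpha A ->
  is_switch P tau X alpha A t0 G0 ->
  is_switch P tau X alpha A t0.+1 G1 ->
  is_Tstar P tau X alpha Gstar ->
  (in_Talpha P tau X alpha G0 /\ in_Talpha P tau X alpha G1) /\
  (model_Ms P tau pd qd ->
   forall t : nat, (1 <= t)%N ->
     [/\ (EU P A t <= EU P G1 t)%E, (EU P G1 t <= EU P G0 t)%E &
         (EU P G0 t <= EU P Gstar t)%E]).
Proof.
move=> K0 [mtau mX pdP qdP law] /andP[/ltW alpha0 _] TA sG0 sG1 sGstar.
have TG0 := switch_in_Talpha mX mtau alpha0 TA sG0.
have TG1 := switch_in_Talpha mX mtau alpha0 TA sG1.
split; first by split.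
move=> [theta [/andP[theta0 theta1] ltau [p [q pq]]]] t t1.
(* The properties of the common densities are read off one stream at time 1, the first time at which
   they are prescribed. *)
pose k0 := Ordinal K0.
have [pE qE] := pq k0 1%N isT.
have := pdP k0 1%N; rewrite pE => -[p0 mp ip].
have := qdP k0 1%N; rewrite qE => -[q0 mq iq].
have [rho [p' [q' [p'0 q'0 mp' mq' rhoE]]]] :
    exists (rho : {finite_measure set Xs -> \bar R}) (p' q' : Xs -> R),
    [/\ forall x, 0 <= p' x, forall x, 0 <= q' x, measurable_fun setT p', measurable_fun setT q' &
      forall B, measurable B ->
        (\int[rho]_(x in B) (p' x)%:E = \int[mu]_(x in B) (p x)%:E)%E /\
        (\int[rho]_(x in B) (q' x)%:E = \int[mu]_(x in B) (q x)%:E)%E].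
  by apply: finite_dominating_measure => //; rewrite ?ip ?iq ltry.
have p1 : (\int[rho]_x (p' x)%:E = 1)%E by rewrite (rhoE _ measurableT).1.
have q1 : (\int[rho]_x (q' x)%:E = 1)%E by rewrite (rhoE _ measurableT).2.
have lawM (v : {ffun 'I_K -> nat}) (F : seq ('I_K * nat)) (B : 'I_K * nat -> set Xs) :
    uniq F -> (forall kt, kt \in F -> (0 < kt.2)%N) -> (forall kt, measurable (B kt)) ->
    P (atom tau v `&` [set w | forall kt, kt \in F -> B kt (X kt.1 kt.2 w)]) =
    ((\prod_k (theta * (1 - theta) ^+ v k)%R)%:E *
    \prod_(kt <- F) \int[rho]_(x in B kt) (if (v kt.1 < kt.2)%N then q' x else p' x)%:E)%E.
  move=> uF F0 mB.
  transitivity (P [set w | (forall k, tau k w = Some (v k)) /\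
      (forall kt, kt \in F -> B kt (X kt.1 kt.2 w))]) => //.
  rewrite (law (fun k => Some (v k)))// ltau; congr (_ * _)%E.
  apply: eq_big_seq => kt /F0 kt0; rewrite /dens /=.
  have [-> ->] := pq kt.1 kt.2 kt0.
  have [rp rq] := rhoE _ (mB kt).
  by case: ifP => _; rewrite ?rp ?rq.
have opt S S' a :=
  @rule_step_optimal _ _ _ _ _ _ _ _ _ _ _ alpha _ _ theta0 theta1 p'0 q'0 mp' mq' p1 q1 mtau mX lawM S S' a.
have [pA _] := TA; have [pG0 _] := TG0; have [pG1 _] := TG1.
have sG : is_switch P tau X alpha A 0 Gstar.
  have [S1 [W SW]] := sGstar.
  split=> //; first by move=> [|s] w.
  by exists W => s; rewrite max0n; exact: SW.
have pGstar := switch_proc pA sG.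
have [A1 _ _] := pA; have [G01 G0A [W0 GW0]] := sG0; have [G11 G1A [W1 GW1]] := sG1.
have [S1 _ [W SW]] := sG.
split.
- apply: (opt A G1 t0.+1) => // [s w st|s st]; first by rewrite G1A.
  by exists (W1 s); apply: GW1; rewrite geq_max st (leq_trans _ st).
(* [G1] is itself in the class and plays the arbitrary procedure. For [t0 = 0] the two still share
   the first active set, whence the maximum. *)
- apply: (opt G1 G0 (maxn t0 1)) => // [|s w|s st]; first by rewrite leq_max orbT.
    move=> /andP[s1]; rewrite leq_max => /orP[st|s0].
      by rewrite G1A ?G0A ?s1//= ltnW.
    by rewrite (_ : s = 1%N) ?G01 ?G11//; apply/eqP; rewrite eqn_leq s0.
  by exists (W0 s); exact: GW0.
- apply: (opt G0 Gstar 1%N) => // [s w|s st].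
    by rewrite -eqn_leq eq_sym => /eqP ->; rewrite G01 S1.
  by exists (W s); exact: SW.
Qed.
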